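(* Let $\mathcal{A}$ be an operator $*$-algebra with involution $\dagger$. Then there exist a Hilbert space $H$, a closed subalgebra $\mathcal{B} \subseteq B(H)$ and a symmetry $u \in B(H)$ together with a completely bounded isomorphism of operator algebras $\pi : \mathcal{A} \to \mathcal{B}$ such that $$\pi(a)^* = u \cdot \pi(a^\dagger) \cdot u \quad \text{for all } a \in \mathcal{A},$$ as an identity in $B(H)$.
   Context: An operator space is a complex vector space $\mathcal{X}$ with norms $\|\cdot\|_{\mathcal{X}}$ on $M_n(\mathcal{X})$, $n\in\mathbb{N}$, such that: $\mathcal{X}=M_1(\mathcal{X})$ is complete; $\|\lambda\xi\mu\|\le\|\lambda\|\,\|\xi\|\,\|\mu\|$ for $\lambda,\mu\in M_n(\mathbb{C})$ (with $C^*$-norms) and $\xi\in M_n(\mathcal{X})$; $\|\xi\oplus\eta\|=\max\{\|\xi\|,\|\eta\|\}$ for $\xi \in M_n(\mathcal{X}), \eta \in M_k(\mathcal{X})$. A linear map is completely bounded if the maps it induces entrywise on all $M_n$ are bounded by one common constant. An operator algebra is an operator space $\mathcal{A}$ that is an algebra over $\mathbb{C}$ with $\|x\cdot y\|\le\|x\|\,\|y\|$ for all $n$ and $x,y\in M_n(\mathcal{A})$ (matrix product). No unit or approximate identity is assumed, and no completely isometric representation on a Hilbert space is assumed. A closed subalgebra of $B(H)$ is an operator algebra with matrix norms from $B(H^{\oplus n})$. An operator $*$-algebra is an operator algebra $\mathcal{A}$ with an involution $\dagger:\mathcal{A}\to\mathcal{A}$ making it a $*$-algebra such that $\|x^\dagger\|=\|x\|$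 for all $n$ and $x\in M_n(\mathcal{A})$, where $(x^\dagger)_{ij}=(x_{ji})^\dagger$. A completely bounded isomorphism (cb-isomorphism) of operator algebras is an invertible algebra homomorphism that is completely bounded together with its inverse. A symmetry is a selfadjoint unitary operator. The symbol $*$ denotes the Hilbert space adjoint. *)

(* Defs.v *)
Set Warnings "-all".
From HB Require Import structures.
From mathcomp Require Import all_boot all_order all_algebra.
From mathcomp Require Import complex.
From mathcomp Require Import all_classical all_reals all_analysis.

Set Implicit Arguments.
Unset Strict Implicit.
Unset Printing Implicit Defensive.

Import Order.TTheory GRing.Theory Num.Theory.
Import numFieldNormedType.Exports.
Local Open Scope classical_set_scope.
Local Open Scope ring_scope.

(* The complex numbers are R[i] for R : realType. Norms on R[i]-modules take
   their (real, nonnegative) values in R[i]; rnorm is the norm as an element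
   of R. *)
Definition rnorm (R : realType) (V : normedZmodType R[i]) (x : V) : R :=
  complex.Re `|x|.

Section RealValuedNorm.
Context {R : realType}.

Lemma rnormE (V : normedZmodType R[i]) (x : V) : (rnorm x)%:C%C = `|x|.
Proof. by rewrite /rnorm RRe_real ?normr_real. Qed.

Lemma rnorm_ge0 (V : normedZmodType R[i]) (x : V) : 0 <= rnorm x.
Proof. by rewrite -ler0c rnormE. Qed.

Lemma rnormD (V : normedZmodType R[i]) (x y : V) :
  rnorm (x + y) <= rnorm x + rnorm y.
Proof. by rewrite -lecR rmorphD/= !rnormE ler_normD. Qed.

Lemma rnorm0 (V : normedZmodType R[i]) : rnorm (0 : V) = 0.
Proof. by rewrite /rnorm normr0. Qed.

Lemma rnorm0_eq0 (V : normedZmodType R[i]) (x : V) : rnorm x = 0 -> x = 0.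
Proof. by move=> x0; apply/normr0_eq0; rewrite -rnormE x0. Qed.

Lemma rnormZ (V : normedModType R[i]) (a : R[i]) (x : V) :
  rnorm (a *: x) = rnorm a * rnorm x.
Proof. by apply: (@complexI R); rewrite rmorphM/= !rnormE normrZ. Qed.

End RealValuedNorm.

(* The Hilbert norm on the direct sum of n copies of V, whose elements are
   column vectors, and the operator norm it induces on maps. *)
Definition l2norm (R : realType) (V : normedZmodType R[i]) (n : nat)
    (v : 'cV[V]_n) : R :=
  Num.sqrt (\sum_i rnorm (v i 0) ^+ 2).

Definition l2opnorm (R : realType) (V W : normedZmodType R[i]) (m n : nat)
    (f : 'cV[V]_m -> 'cV[W]_n) : R :=
  sup [set l2norm (f v) | v in [set v | l2norm v <= 1]].

Definition cstar_norm (R : realType) (n : nat) (l : 'M[R[i]]_n) : R :=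
  l2opnorm (mulmx l : 'cV[R[i]]_n -> 'cV[R[i]]_n).

Definition mx_bimodule (K : pzRingType) (V : lmodType K) (n : nat)
    (l : 'M[K]_n) (x : 'M[V]_n) (m : 'M[K]_n) : 'M[V]_n :=
  \matrix_(i, j) \sum_p \sum_q (l i p * m q j) *: x p q.

Definition mx_product (V : nmodType) (mul : V -> V -> V) (n : nat)
    (x y : 'M[V]_n) : 'M[V]_n :=
  \matrix_(i, j) \sum_k mul (x i k) (y k j).

HB.mixin Record hasMatrixNorm (R : realType) X of GRing.Lmodule R[i] X := {
  mnorm : forall n : nat, 'M[X]_n -> R
}.

#[short(type="matrixNormedType")]
HB.structure Definition MatrixNormed (R : realType) :=
  { X of GRing.Lmodule R[i] X & hasMatrixNorm R X }.

Arguments mnorm {R s n} x : rename.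

(* The case n = 0 is included for uniformity: 'M[X]_0 is the zero space, on
   which the axioms force the norm to be 0. *)
HB.mixin Record isOperatorSpace (R : realType) X
    of CompleteNormedModule R[i] X & MatrixNormed R X := {
  mnormD : forall (n : nat) (x y : 'M[X]_n),
    mnorm (x + y) <= mnorm x + mnorm y;
  mnormZ : forall (n : nat) (a : R[i]) (x : 'M[X]_n),
    mnorm (map_mx ( *:%R a) x) = rnorm a * mnorm x;
  mnorm_eq0 : forall (n : nat) (x : 'M[X]_n), mnorm x = 0 -> x = 0;
  mnorm_M1 : forall x : X, mnorm (const_mx x : 'M[X]_1) = rnorm x;
  mnorm_bimodule : forall (n : nat) (l : 'M[R[i]]_n) (x : 'M[X]_n)
      (m : 'M[R[i]]_n),
    mnorm (mx_bimodule l x m) <= cstar_norm l * mnorm x * cstar_norm m;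
  mnorm_dsum : forall (n k : nat) (x : 'M[X]_n) (y : 'M[X]_k),
    mnorm (block_mx x 0 0 y) = Num.max (mnorm x) (mnorm y)
}.

#[short(type="operatorSpaceType")]
HB.structure Definition OperatorSpace (R : realType) :=
  { X of CompleteNormedModule R[i] X & MatrixNormed R X & isOperatorSpace R X }.

HB.mixin Record isOperatorAlgebra (R : realType) A of OperatorSpace R A := {
  oamul : {bilinear A -> A -> A};
  oamulA : forall x y z : A, oamul x (oamul y z) = oamul (oamul x y) z;
  mnormM : forall (n : nat) (x y : 'M[A]_n),
    mnorm (mx_product oamul x y) <= mnorm x * mnorm y
}.

#[short(type="operatorAlgType")]
HB.structure Definition OperatorAlgebra (R : realType) :=
  { A of OperatorSpace R A & isOperatorAlgebra R A }.

HB.mixin Record isOperatorStarAlgebra (R : realType) A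
    of OperatorAlgebra R A := {
  dagger : A -> A;
  daggerD : forall x y : A, dagger (x + y) = dagger x + dagger y;
  daggerZ : forall (a : R[i]) (x : A), dagger (a *: x) = a^* *: dagger x;
  daggerM : forall x y : A, dagger (oamul x y) = oamul (dagger y) (dagger x);
  daggerK : forall x : A, dagger (dagger x) = x;
  mnorm_dagger : forall (n : nat) (x : 'M[A]_n),
    mnorm (\matrix_(i, j) dagger (x j i)) = mnorm x
}.

#[short(type="operatorStarAlgType")]
HB.structure Definition OperatorStarAlgebra (R : realType) :=
  { A of OperatorAlgebra R A & isOperatorStarAlgebra R A }.

(* The inner product is linear in its first argument. *)
HB.mixin Record isHilbert (R : realType) H of CompleteNormedModule R[i] H := {
  hdot : {dot H for (@Num.conj R[i])};
  hdotE : forall x : H, hdot x x = `|x| ^+ 2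
}.

#[short(type="hilbertType")]
HB.structure Definition Hilbert (R : realType) :=
  { H of CompleteNormedModule R[i] H & isHilbert R H }.

Definition bounded_op (R : realType) (H : hilbertType R) : {pred H -> H} :=
  [pred f : H -> H | `[< linear f /\
    exists c : R, forall x, rnorm (f x) <= c * rnorm x >]].

Record bop (R : realType) (H : hilbertType R) := BOp {
  bop_fun :> H -> H;
  bop_subproof : bop_fun \in @bounded_op R H
}.

Section BoundedOperators.
Context {R : realType} {H : hilbertType R}.

Lemma bounded_opP (f : H -> H) : reflect
  (linear f /\ exists2 c : R, 0 <= c & forall x, rnorm (f x) <= c * rnorm x)
  (f \in @bounded_op R H).
Proof.
apply: (iffP (asboolP _)) => -[fl [c]]; last by move=> _ fc; split=> //; exists c.
move=> fc; split=> //; exists (Num.max c 0); first by rewrite le_max lexx orbT.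
move=> x; apply: (le_trans (fc x)).
by rewrite ler_wpM2r ?rnorm_ge0// le_max lexx.
Qed.

Fact bounded_op_submod_closed : submod_closed (@bounded_op R H).
Proof.
split=> [|a f g /bounded_opP[fl [c c0 fc]] /bounded_opP[gl [d d0 gd]]].
  apply/bounded_opP; split=> [b x y|]; first by rewrite /= scaler0 addr0.
  by exists 0 => // x; rewrite mul0r rnorm0.
apply/bounded_opP; split=> [b x y|].
  rewrite -![(a *: f + g) _]/(a *: f _ + g _) fl gl.
  by rewrite !scalerDr !scalerA [a * b]mulrC addrACA.
exists (rnorm a * c + d); first by rewrite addr_ge0 ?mulr_ge0 ?rnorm_ge0.
move=> x; apply: (le_trans (rnormD _ _)); rewrite mulrDl lerD//.
by rewrite rnormZ -mulrA ler_wpM2l ?rnorm_ge0.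
Qed.

HB.instance Definition _ := GRing.isSubmodClosed.Build R[i] (H -> H)
  (@bounded_op R H) bounded_op_submod_closed.

HB.instance Definition _ := [isSub for @bop_fun R H].
HB.instance Definition _ := [Choice of bop H by <:].
HB.instance Definition _ := [SubChoice_isSubLmodule of bop H by <:].

Lemma bop_linear (T : bop H) : linear T.
Proof. by have /bounded_opP[] := bop_subproof T. Qed.

Lemma bop_bounded (T : bop H) :
  exists2 c : R, 0 <= c & forall x, rnorm (T x) <= c * rnorm x.
Proof. by have /bounded_opP[] := bop_subproof T. Qed.

Lemma bop_ext (S T : bop H) : S =1 T -> S = T.
Proof. by move=> ST; apply/val_inj/funext. Qed.

Fact bop_comp_subproof (S T : bop H) : S \o T \in @bounded_op R H.
Proof.
have [c c0 Sc] := bop_bounded S; have [d d0 Td] := bop_bounded T.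
apply/bounded_opP; split=> [a x y|]; first by rewrite /= !bop_linear.
exists (c * d) => [|x]; first exact: mulr_ge0.
by apply: (le_trans (Sc _)); rewrite -mulrA ler_wpM2l.
Qed.

Definition bop_comp (S T : bop H) : bop H := BOp (bop_comp_subproof S T).

Fact bop_id_subproof : idfun \in @bounded_op R H.
Proof. by apply/bounded_opP; split=> //; exists 1 => // x; rewrite mul1r. Qed.

Definition bop_id : bop H := BOp bop_id_subproof.

Definition bop_norm (T : bop H) : R :=
  sup [set rnorm (T x) | x in [set x : H | rnorm x <= 1]].

Lemma bop_normP (T : bop H) x : rnorm (T x) <= bop_norm T * rnorm x.
Proof.
have T0 : T 0 = 0.
  by have := bop_linear T (-1) 0 0; rewrite scaler0 addr0 scaleN1r addNr.
have [c c0 Tc] := bop_bounded T.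
have [x0|x0] := eqVneq (rnorm x) 0.
  by rewrite (rnorm0_eq0 x0) T0 !rnorm0 mulr0.
have xgt0 : 0 < rnorm x by rewrite lt_def x0 rnorm_ge0.
have TZ a y : T (a *: y) = a *: T y.
  by have := bop_linear T a y 0; rewrite T0 !addr0.
rewrite -ler_pdivrMr// mulrC.
have rx : rnorm ((rnorm x)^-1%:C%C) = (rnorm x)^-1.
  apply: (@complexI R); rewrite rnormE ger0_norm// ler0c.
  by rewrite invr_ge0 ltW.
rewrite -{1}rx -rnormZ -TZ; apply: ub_le_sup; last first.
  by exists ((rnorm x)^-1%:C%C *: x) => //=; rewrite rnormZ rx mulVf.
exists c => _ [y /= y1 <-]; apply: (le_trans (Tc y)).
by rewrite -{2}[c]mulr1 ler_wpM2l.
Qed.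

Lemma bop_norm_le (T : bop H) (c : R) : 0 <= c ->
  (forall x, rnorm (T x) <= c * rnorm x) -> bop_norm T <= c.
Proof.
move=> c0 Tc; apply: ge_sup.
  by exists (rnorm (T 0)), 0 => //=; rewrite rnorm0.
move=> _ [x /= x1 <-]; apply: (le_trans (Tc x)).
by rewrite -{2}[c]mulr1 ler_wpM2l.
Qed.

Lemma bop_norm_ge0 (T : bop H) : 0 <= bop_norm T.
Proof.
have [c c0 Tc] := bop_bounded T.
apply: le_trans (rnorm_ge0 (T 0)) _; apply: ub_le_sup.
  exists c => _ [y /= y1 <-]; apply: (le_trans (Tc y)).
  by rewrite -{2}[c]mulr1 ler_wpM2l.
by exists 0 => //=; rewrite rnorm0.
Qed.

Fact bop_normD (S T : bop H) :
  (bop_norm (S + T))%:C%C <= (bop_norm S)%:C%C + (bop_norm T)%:C%C.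
Proof.
rewrite -rmorphD/= lecR; apply: bop_norm_le => [|x].
  by rewrite addr_ge0 ?bop_norm_ge0.
by apply: (le_trans (rnormD _ _)); rewrite mulrDl lerD// bop_normP.
Qed.

Fact bop_normZ (a : R[i]) (T : bop H) :
  (bop_norm (a *: T))%:C%C = `|a| * (bop_norm T)%:C%C.
Proof.
have leZ b (S : bop H) : bop_norm (b *: S) <= rnorm b * bop_norm S.
  apply: bop_norm_le => [|x]; first by rewrite mulr_ge0 ?rnorm_ge0 ?bop_norm_ge0.
  by rewrite -mulrA -[(b *: S) x]/(b *: S x) rnormZ ler_wpM2l ?rnorm_ge0 ?bop_normP.
rewrite -rnormE -rmorphM/=; congr (_%:C%C); apply/eqP; rewrite eq_le leZ/=.
have [->|a0] := eqVneq a 0; first by rewrite rnorm0 mul0r bop_norm_ge0.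
have ra : 0 < rnorm a.
  by rewrite lt_def rnorm_ge0 andbT; apply: contra_neq a0; exact: rnorm0_eq0.
rewrite -ler_pdivlMl//; have := leZ a^-1 (a *: T).
rewrite scalerA mulVf// scale1r; congr (_ <= _ * _).
by apply: (@complexI R); rewrite fmorphV/= !rnormE normfV.
Qed.

Fact bop_norm0_eq0 (T : bop H) : (bop_norm T)%:C%C = 0 -> T = 0.
Proof.
move=> /complexI T0; apply: bop_ext => x; apply: rnorm0_eq0; apply/eqP.
by rewrite eq_le rnorm_ge0 andbT (le_trans (bop_normP T x))// T0 mul0r.
Qed.

HB.instance Definition _ := Lmodule_isNormed.Build R[i] (bop H)
  bop_normD bop_normZ bop_norm0_eq0.

(* An n x n matrix of operators acts on the direct sum of n copies of H. *)
Definition bop_mx_fun (n : nat) (T : 'M[bop H]_n) (v : 'cV[H]_n) : 'cV[H]_n :=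
  \col_i \sum_j T i j (v j 0).

HB.instance Definition _ := hasMatrixNorm.Build R (bop H)
  (fun (n : nat) (T : 'M[bop H]_n) => l2opnorm (bop_mx_fun T)).

End BoundedOperators.

(* S is the adjoint of T. *)
Definition is_adjoint (R : realType) (H : hilbertType R) (T S : bop H) : Prop :=
  forall x y : H, hdot (T x) y = hdot x (S y).

Lemma is_adjoint_unique (R : realType) (H : hilbertType R) (T S S' : bop H) :
  is_adjoint T S -> is_adjoint T S' -> S = S'.
Proof.
move=> TS TS'; apply: bop_ext => y; apply/eqP.
rewrite -subr_eq0 -normr_eq0 -sqrf_eq0 -hdotE.
by rewrite linearBr /= -TS -TS' subrr.
Qed.

Definition unitary_op (R : realType) (H : hilbertType R) (u : bop H) : Prop :=
  exists v : bop H,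
    [/\ is_adjoint u v, bop_comp u v = bop_id & bop_comp v u = bop_id].

Definition symmetry (R : realType) (H : hilbertType R) (u : bop H) : Prop :=
  is_adjoint u u /\ unitary_op u.

Record closed_subalgebra (R : realType) (H : hilbertType R)
    (B : set (bop H)) : Prop := ClosedSubalgebra {
  subalgebra0 : B 0;
  subalgebraP : forall (a : R[i]) (S T : bop H), B S -> B T -> B (a *: S + T);
  subalgebraM : forall S T : bop H, B S -> B T -> B (bop_comp S T);
  subalgebra_closed : closed B
}.

(* Complete boundedness of a map f that is only considered on the subspace D
   of X, with the matrix norms of X restricted to D. *)
Definition completely_bounded_on (R : realType) (X Y : matrixNormedType R)
    (D : set X) (f : X -> Y) : Prop :=
  exists c : R, forall (n : nat) (x : 'M[X]_n),
    (forall i j, D (x i j)) -> mnorm (map_mx f x) <= c * mnorm x.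

(* Only the values of the inverse g on the subalgebra B of B(H) are relevant. *)
Definition cb_isomorphism_onto (R : realType) (A : operatorAlgType R)
    (H : hilbertType R) (B : set (bop H)) (f : {linear A -> bop H}) : Prop :=
  [/\ forall x y : A, f (oamul x y) = bop_comp (f x) (f y),
      completely_bounded_on setT f &
      exists g : bop H -> A,
        [/\ forall x : A, B (f x), cancel f g, {in B, cancel g f} &
            completely_bounded_on B g]].

(* Main.v *)
Require Import Defs.
Set Warnings "-all".
From HB Require Import structures.
From mathcomp Require Import all_boot all_order all_algebra.
From mathcomp Require Import complex.
From mathcomp Require Import all_classical all_reals all_analysis.
From mathcomp Require Import ring lra.

Set Implicit Arguments.
Unset Strict Implicit.
Unset Printing Implicit Defensive.

Import Order.TTheory GRing.Theory Num.Theory.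
Import numFieldNormedType.Exports.
Local Open Scope classical_set_scope.
Local Open Scope ring_scope.

(* It suffices to represent A on a Hilbert space K by a homomorphism pi that is
   a complete isomorphism onto its range: on K + K put
   [f(a) = pi(a) + pi(a^dagger)^*] and let u be the flip.

   To find pi, fix [x] in M_n(A) and let A act from the right on columns of
   length n over the unitization of A. We look for a Hilbertian semi-norm [P^(1/2)]
   on this space such that right multiplication of rows by matrices [c] over A
   with [|c| <= 1/2] is contractive, [P] has total mass at most 1 on the
   standard basis, and total mass at least [|x|^2] on the columns of [x]. Such
   [P] are the additive functionals on finite families of columns that are
   monotone for the preorder "z dominated by y": for some family k,
   [k ++ z = T (k c ++ y)] with [T] a scalar contraction and [|c| <= 1/2]. By
   Hahn-Banach, [P] exists as soon as the columns of [x] are dominated only by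
   scalar families of row norm at least [|x|], which is the estimate
   [|Z| <= (|Z| + |L|) / 2] for the A-part Z and the scalar part L of [k ++ z].

   The bounded linear functionals on the direct sum of these spaces over all
   [x] form K, and [pi(a) g = g(. a)]. The factor 1/2 gives
   [|x| <= |pi_n(x)| <= 2 |x|]. *)

(** * Quadratic forms satisfying the parallelogram law *)

(** With no Hilbert space, unit or approximate identity given, the vectors have to come from the
    columns of [x]. The adjoined unit carries no matrix norm; it only supplies the scalar columns
    [cunit s], from which the entries of [x] produce the columns of [x]. In the unitization a right
    factor c acts on both Z and L, and |c| <= s gives |Z| <= s (|Z| + |L|). For s = 1 this says
    nothing; for s < 1 it yields |Z| <= s / (1 - s) |L|, and 1/2 is the value with constant 1. The
    price is an isomorphism with upper constant 2 instead of an isometry.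

    Families under concatenation have no subtraction, so Hahn-Banach is proved for a preordered
    monoid. The semi-norms obtained need be neither definite nor complete. Their spaces of bounded
    functionals are both, so quotients and completions are avoided, and passing to functionals turns
    the right action into a left one. Since [dagger] and the Hilbert adjoint both reverse products
    and conjugate scalars, the second summand of f is again a linear homomorphism. *)

Lemma additive_bounded_linear (R : realType) (g : R -> R) (K : R) :
  {morph g : x y / x + y} -> (forall t, `|t| <= 1 -> `|g t| <= K) ->
  forall t, g t = t * g 1.
Proof.
move=> gD gK t.
have g0 : g 0 = 0 by apply: (addrI (g 0)); rewrite -gD !addr0.
have gN x : g (- x) = - g x by apply/eqP; rewrite -addr_eq0 -gD addNr g0.
have gn n x : g (n%:R * x) = n%:R * g x.
  elim: n => [|n IH]; first by rewrite !mul0r g0.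
  by rewrite -natr1 !mulrDl !mul1r gD IH.
have gz (n : int) : g n%:~R = n%:~R * g 1.
  case: n => n; first by have := gn n 1; rewrite mulr1.
  by rewrite NegzE !mulrNz gN mulNr; have := gn n.+1 1; rewrite mulr1 => ->.
(* The defect [h] is additive and vanishes on integers, so its values on [0, 1) bound it everywhere;
   a bounded additive function is zero by the Archimedean property. *)
pose h x := g x - x * g 1.
have hK x : `|h x| <= K + `|g 1|.
  have -> : h x = g (x - (Num.floor x)%:~R) - (x - (Num.floor x)%:~R) * g 1.
    by rewrite /h gD gN gz; ring.
  have f1 := floor_le x; have f2 := floorD1_gt x; rewrite intrD in f2.
  have xf : `|x - (Num.floor x)%:~R| <= 1 by rewrite ger0_norm; lra.
  rewrite (le_trans (ler_normB _ _))// lerD ?gK// normrM.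
  by rewrite -[leRHS]mul1r ler_wpM2r.
suff : h t = 0 by move/eqP; rewrite subr_eq0 => /eqP.
have hn n : h (n%:R * t) = n%:R * h t.
  by rewrite /h gn -mulrA -mulrBr.
apply/eqP/negPn/negP => ht0.
have ht : 0 < `|h t| by rewrite normr_gt0.
have K0 : 0 <= K + `|g 1| by exact: le_trans (normr_ge0 _) (hK 0).
have := Num.Theory.archi_boundP (divr_ge0 K0 (ltW ht)).
rewrite ltr_pdivrMr// ltNge; set n := Num.bound _.
by have := hK (n%:R * t); rewrite hn normrM ger0_norm// => ->.
Qed.

Section ComplexFacts.
Context {R : realType}.
Implicit Types a b z : R[i].

Lemma rnorm_sqr z : rnorm z ^+ 2 = complex.Re z ^+ 2 + complex.Im z ^+ 2.
Proof. by case: z => x y; rewrite /rnorm /= sqr_sqrtr// addr_ge0 ?sqr_ge0. Qed.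

Lemma rnormM a b : rnorm (a * b) = rnorm a * rnorm b.
Proof. by apply: (@complexI R); rewrite rmorphM /= !rnormE normrM. Qed.

Lemma Re_le_rnorm z : complex.Re z <= rnorm z.
Proof.
apply: (le_trans (ler_norm _)).
by rewrite -(@ler_pXn2r _ 2)// ?nnegrE ?rnorm_ge0// rnorm_sqr real_normK ?num_real// lerDl sqr_ge0.
Qed.

Lemma rnorm_real (x : R) : rnorm (x%:C%C : R[i]) = `|x|.
Proof. by rewrite /rnorm /= expr0n addr0 sqrtr_sqr. Qed.

Lemma rnorm_i : rnorm ('i%C : R[i]) = 1.
Proof. by rewrite /rnorm /= expr0n add0r expr1n sqrtr1. Qed.

Lemma rnorm1 : rnorm (1 : R[i]) = 1.
Proof. by rewrite -[1 in LHS]/(1%:C)%C rnorm_real normr1. Qed.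

Lemma rnormN (V : normedZmodType R[i]) (x : V) : rnorm (- x) = rnorm x.
Proof. by rewrite /rnorm normrN. Qed.

Lemma ReD a b : complex.Re (a + b) = complex.Re a + complex.Re b.
Proof. exact: raddfD. Qed.

Lemma ImD a b : complex.Im (a + b) = complex.Im a + complex.Im b.
Proof. exact: raddfD. Qed.

Lemma Im_real_mul (x : R) z : complex.Im (x%:C%C * z) = x * complex.Im z.
Proof. by case: z => u v /=; rewrite mul0r addr0. Qed.

Lemma ReN a : complex.Re (- a) = - complex.Re a.
Proof. exact: raddfN. Qed.

Lemma complex_split z : z = (complex.Re z)%:C%C + 'i%C * (complex.Im z)%:C%C.
Proof. exact: complexE. Qed.

Lemma Re_real_mul (x : R) z : complex.Re (x%:C%C * z) = x * complex.Re z.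
Proof. by case: z => u v /=; rewrite mul0r subr0. Qed.

Lemma Re_i_mul z : complex.Re ('i%C * z) = - complex.Im z.
Proof. by case: z => u v /=; rewrite mul0r mul1r add0r. Qed.

Lemma complex_eqRe z w : complex.Re z = complex.Re w ->
  complex.Re ('i%C * z) = complex.Re ('i%C * w) -> z = w.
Proof.
rewrite !Re_i_mul => h /oppr_inj h'; apply/eqP.
by rewrite eq_complex h h' !eqxx.
Qed.

End ComplexFacts.

Lemma scale_halfD (R : realType) (V : lmodType R[i]) (v : V) :
  2^-1%:C%C *: (v + v) = v.
Proof.
by rewrite scalerDr -scalerDl -rmorphD /= -[2^-1]mul1r -splitr scale1r.
Qed.

Lemma discriminant_le (R : realType) (a b c : R) : 0 <= a -> 0 <= c ->
  (forall t, 2 * t * b <= a + t ^+ 2 * c) -> b ^+ 2 <= a * c.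
Proof.
move=> a0 c0 abc; have [c_eq0|cn0] := eqVneq c 0.
  have [->|b0] := eqVneq b 0; first by rewrite expr0n mulr_ge0.
  (* With [c = 0] and [b != 0], this [t] turns the hypothesis into [a + 1 <= a]. *)
  have := abc ((a + 1) / (2 * b)); rewrite c_eq0.
  rewrite (_ : 2 * _ * _ = a + 1); first by lra.
  by field.
have cp : 0 < c by rewrite lt_def cn0.
have := abc (b / c); rewrite -subr_ge0.
rewrite (_ : _ - _ = (a * c - b ^+ 2) / c); last by field.
by rewrite pmulr_lge0 ?invr_gt0// subr_ge0.
Qed.

(* The three axioms force [qf] to be the square of a Hilbertian semi-norm:
   real homogeneity of the polar form follows from additivity and boundedness
   (Jordan-von Neumann). *)
Record qform (R : realType) (V : lmodType R[i]) := QForm {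
  qf :> V -> R;
  qf_ge0 : forall v, 0 <= qf v;
  qf_par : forall u v, qf (u + v) + qf (u - v) = 2 * (qf u + qf v);
  qf_contract : forall a v, rnorm a <= 1 -> qf (a *: v) <= qf v
}.

Section QForm.
Context {R : realType} {V : lmodType R[i]} (q : qform V).
Implicit Types (u v w : V) (a : R[i]) (t : R).

Lemma qf0 : q 0 = 0.
Proof. by have := qf_par q 0 0; rewrite addr0 subr0; lra. Qed.

Lemma qf_unit a v : rnorm a = 1 -> q (a *: v) = q v.
Proof.
move=> a1; apply/eqP; rewrite eq_le qf_contract ?a1//=.
have a0 : a != 0.
  by apply/eqP => a0; move: a1; rewrite a0 rnorm0 => /eqP; rewrite eq_sym oner_eq0.
rewrite -{1}[v](scalerK a0) qf_contract//.
suff -> : rnorm a^-1 = 1 by [].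
by rewrite -[LHS]mulr1 -a1 -rnormM mulVf// rnorm1.
Qed.

Lemma qfN v : q (- v) = q v.
Proof. by rewrite -scaleN1r qf_unit// rnormN rnorm1. Qed.

Definition rform u v : R := (q (u + v) - q (u - v)) / 4.

Lemma rformC u v : rform u v = rform v u.
Proof. by rewrite /rform [u + v]addrC -(opprB v u) qfN. Qed.

Let rform0l v : rform 0 v = 0.
Proof. by rewrite /rform add0r sub0r qfN subrr mul0r. Qed.

(** Difference of the parallelogram laws at [(u + v, w)] and [(u - v, w)]. Additivity of [rform] is
    its instance at [u + w] and [u - w]. *)
Let rform_mid u w v : rform (u + w) v + rform (u - w) v = 2 * rform u v.
Proof.
have := qf_par q (u + v) w; have := qf_par q (u - v) w.
rewrite /rform -!addrA ![w + _]addrC ![- w + _]addrC !addrA; lra.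
Qed.

Let rform2 u v : rform (u + u) v = 2 * rform u v.
Proof. by have := rform_mid u u v; rewrite subrr rform0l addr0. Qed.

Lemma rformDl u w v : rform (u + w) v = rform u v + rform w v.
Proof.
have := rform_mid (u + w) (u - w) v.
rewrite opprB addrACA subrr addr0 rform2.
rewrite (_ : u + w + (w - u) = w + w); last by rewrite addrC addrA subrK.
rewrite rform2; lra.
Qed.

Lemma rformNl u v : rform (- u) v = - rform u v.
Proof. by apply/eqP; rewrite -addr_eq0 -rformDl addNr rform0l. Qed.

Lemma rformDr u w v : rform v (u + w) = rform v u + rform v w.
Proof. by rewrite !(rformC v) rformDl. Qed.

Lemma rformNr u v : rform u (- v) = - rform u v.
Proof. by rewrite !(rformC u) rformNl. Qed.

Lemma rformvv v : rform v v = q v.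
Proof.
have := qf_par q v v; rewrite /rform subrr qf0; lra.
Qed.

Lemma qfD u v : q (u + v) = q u + 2 * rform u v + q v.
Proof. by rewrite -!rformvv rformDl !rformDr (rformC v u); lra. Qed.

Lemma qfB u v : q (u - v) = q u - 2 * rform u v + q v.
Proof. by rewrite qfD rformNr qfN; lra. Qed.

Lemma rform_le u v : 2 * rform u v <= q u + q v.
Proof. by have := qf_ge0 q (u - v); rewrite qfB; lra. Qed.

Lemma rformZl t u v : rform (t%:C%C *: u) v = t * rform u v.
Proof.
rewrite (@additive_bounded_linear _ (fun t => rform (t%:C%C *: u) v) (q u + q v)).
- by rewrite scale1r.
- by move=> x y; rewrite rmorphD/= scalerDl rformDl.
move=> x x1; have qx : q (x%:C%C *: u) <= q u by rewrite qf_contract// rnorm_real.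
have := rform_le (x%:C%C *: u) v; have := rform_le (x%:C%C *: u) (- v).
rewrite rformNr qfN ler_norml => h1 h2.
by have := qf_ge0 q v; have := qf_ge0 q u; move=> ? ?; apply/andP; split; lra.
Qed.

Lemma rformZr t u v : rform u (t%:C%C *: v) = t * rform u v.
Proof. by rewrite !(rformC u) rformZl. Qed.

Lemma qf_realZ t v : q (t%:C%C *: v) = t ^+ 2 * q v.
Proof. by rewrite -!rformvv rformZl rformZr mulrA. Qed.

Lemma rform_ii u v : rform ('i%C *: u) ('i%C *: v) = rform u v.
Proof. by rewrite /rform -scalerDr -scalerBr !qf_unit// rnorm_i. Qed.

Lemma rform_il u v : rform ('i%C *: u) v = - rform u ('i%C *: v).
Proof.
rewrite -rform_ii scalerA (_ : 'i%C * 'i%C = - 1); last first.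
  by rewrite -expr2 sqr_i.
by rewrite scaleN1r rformNl.
Qed.

Lemma rform_ir u v : rform u ('i%C *: v) = - rform ('i%C *: u) v.
Proof. by rewrite rform_il opprK. Qed.

Lemma rform_CS u v : rform u v ^+ 2 <= q u * q v.
Proof.
apply: discriminant_le; rewrite ?qf_ge0// => t.
by have := rform_le u (t%:C%C *: v); rewrite rformZr qf_realZ mulrA.
Qed.

Lemma rform_sqrt u v : rform u v <= Num.sqrt (q u) * Num.sqrt (q v).
Proof.
rewrite -sqrtrM ?qf_ge0//; apply: (le_trans (ler_norm _)).
by rewrite -sqrtr_sqr ler_sqrt ?rform_CS// mulr_ge0 ?qf_ge0.
Qed.

Lemma sqrt_qfD u v : Num.sqrt (q (u + v)) <= Num.sqrt (q u) + Num.sqrt (q v).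
Proof.
rewrite -[leRHS]ger0_norm ?addr_ge0 ?sqrtr_ge0// -sqrtr_sqr ler_sqrt ?sqr_ge0//.
rewrite sqrrD !sqr_sqrtr ?qf_ge0// qfD -[_ *+ 2]mulr_natl.
by have := rform_sqrt u v; lra.
Qed.

(** Linearity in the first argument dictates the imaginary part: Im <u, v> = Re <u, i v>. *)
Definition cform u v : R[i] := (rform u v +i* rform u ('i%C *: v))%C.

Lemma Re_cform u v : complex.Re (cform u v) = rform u v.
Proof. by []. Qed.

Lemma cformDl u w v : cform (u + w) v = cform u v + cform w v.
Proof. by rewrite /cform !rformDl. Qed.

Lemma cformZl a u v : cform (a *: u) v = a * cform u v.
Proof.
case: a => x y.
rewrite {1}(complex_split (x +i* y)%C) /= scalerDl -scalerA cformDl.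
rewrite /cform rform_ii rform_il !rformZl; apply/eqP.
by rewrite eq_complex /=; apply/andP; split; apply/eqP; ring.
Qed.

Lemma cformC u v : (cform u v)^* = cform v u.
Proof.
rewrite /cform /conjc /= -[RHS]/(_ +i* _)%C (rformC u v); congr (_ +i* _)%C.
by rewrite rform_ir opprK rformC.
Qed.

Lemma cformNr u v : cform u (- v) = - cform u v.
Proof. by rewrite -(cformC (- v)) -scaleN1r cformZl mulN1r rmorphN /= cformC. Qed.

Lemma rform_vi v : rform v ('i%C *: v) = 0.
Proof. by have := rform_ir v v; rewrite (rformC ('i%C *: v)); lra. Qed.

Lemma cformvv v : cform v v = (q v)%:C%C.
Proof. by rewrite /cform rformvv rform_vi. Qed.

Lemma qfZ a v : q (a *: v) = rnorm a ^+ 2 * q v.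
Proof.
rewrite rnorm_sqr {1}(complex_split a) scalerDl -scalerA qfD.
rewrite (qf_unit _ rnorm_i) !qf_realZ rformZl scalerA (mulrC 'i%C) -scalerA rformZr.
by rewrite rform_vi; ring.
Qed.

End QForm.

(** * Hilbert spaces from complete quadratic forms *)

Definition q_cauchy (R : realType) (V : zmodType) (q : V -> R) (u : nat -> V) :=
  forall e : R, 0 < e ->
    exists n0, forall m n, (n0 <= m)%N -> (n0 <= n)%N -> q (u m - u n) < e.

Definition q_converges (R : realType) (V : zmodType) (q : V -> R)
    (u : nat -> V) (l : V) :=
  forall e : R, 0 < e -> exists n0, forall n, (n0 <= n)%N -> q (u n - l) < e.

Record rawHilbert (R : realType) := RawHilbert {
  rh_sort :> lmodType R[i];
  rh_form : qform rh_sort;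
  rh_definite : forall v, rh_form v = 0 -> v = 0;
  rh_complete : forall u, q_cauchy rh_form u -> exists l, q_converges rh_form u l
}.

(** Links Cauchy filters with the sequential completeness of [rawHilbert]: balls of radius 1/(k+1)
    belonging to the filter are picked, and any two of them meet. *)
Lemma cauchy_ball_seq (R : realType) (V : normedModType R[i])
    (F : set_system V) : ProperFilter F -> cauchy F ->
  exists u : nat -> V, (forall k, F (ball (u k) (k.+1%:R^-1)%:C%C)) /\
    forall m n, rnorm (u m - u n) < m.+1%:R^-1 + n.+1%:R^-1.
Proof.
move=> FF /cauchyP Fex.
have P k : exists x, F (ball x ((k.+1%:R^-1 : R)%:C%C)).
  by apply: Fex; rewrite ltcR invr_gt0.
have [u uP] := choice P; exists u; split=> // m n.
have [y [/= ym yn]] := filter_ex (filterI (uP m) (uP n)).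
rewrite -ltcR rnormE rmorphD /=.
rewrite -(subrKA y) (le_lt_trans (ler_normD _ _))// ltrD//.
  by move: ym; rewrite -ball_normE.
by move: yn; rewrite -ball_normE /= distrC.
Qed.

Section HilbertSpaceOfForm.
Context {R : realType} (X : rawHilbert R).

Definition hilb : Type := rh_sort X.
HB.instance Definition _ := GRing.Lmodule.copy hilb (rh_sort X).

Let N := rh_form X.

Definition hilb_norm (v : hilb) : R[i] := (Num.sqrt (N v))%:C%C.

Fact hilb_normD (u v : hilb) : hilb_norm (u + v) <= hilb_norm u + hilb_norm v.
Proof. by rewrite /hilb_norm -rmorphD lecR sqrt_qfD. Qed.

Fact hilb_normZ (a : R[i]) (v : hilb) : hilb_norm (a *: v) = `|a| * hilb_norm v.
Proof.
rewrite /hilb_norm -rnormE -rmorphM /=.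
rewrite -[LHS]/((Num.sqrt (N (a *: (v : rh_sort X))))%:C%C).
by rewrite qfZ sqrtrM ?sqr_ge0// sqrtr_sqr ger0_norm ?rnorm_ge0.
Qed.

Fact hilb_norm_eq0 (v : hilb) : hilb_norm v = 0 -> v = 0.
Proof.
move=> /complexI/eqP; rewrite sqrtr_eq0 => v0; apply: (@rh_definite _ X).
by apply/eqP; rewrite eq_le v0 qf_ge0.
Qed.

HB.instance Definition _ := Lmodule_isNormed.Build R[i] hilb
  hilb_normD hilb_normZ hilb_norm_eq0.

Lemma rnorm_hilb (v : hilb) : rnorm v = Num.sqrt (N v).
Proof. by []. Qed.

Lemma rnorm_hilb_sqr (v : hilb) : rnorm v ^+ 2 = N v.
Proof. by rewrite rnorm_hilb sqr_sqrtr ?qf_ge0. Qed.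

Fact hilb_complete (F : set_system hilb) : ProperFilter F -> cauchy F -> cvg F.
Proof.
move=> FF Fc; have [u [uF uu]] := cauchy_ball_seq FF Fc.
have [|l lP] := @rh_complete _ X u.
  move=> e e0; have se : 0 < Num.sqrt e by rewrite sqrtr_gt0.
  exists (Num.bound (2 / Num.sqrt e)) => m n m0 n0.
  rewrite -rnorm_hilb_sqr -(sqr_sqrtr (ltW e0)) ltr_pXn2r ?nnegrE ?rnorm_ge0 ?sqrtr_ge0//.
  apply: (lt_le_trans (uu m n)); rewrite (splitr (Num.sqrt e)).
  have bd k : (Num.bound (2 / Num.sqrt e) <= k)%N -> k.+1%:R^-1 <= Num.sqrt e / 2.
    move=> kb; rewrite -[_ / 2]invrK lef_pV2 ?posrE ?invr_gt0 ?divr_gt0//.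
    rewrite invf_div; apply: ltW; apply: (lt_le_trans (archi_boundP _)).
      by rewrite divr_ge0// ltW.
    by rewrite ler_nat (leq_trans kb).
  by rewrite lerD// bd.
apply/cvg_ex; exists (l : hilb); apply/fcvgrPdist_lt => e e0.
have er : 0 < complex.Re e by move: e0; rewrite ltcE => /andP[].
have eE : e = (complex.Re e)%:C%C by rewrite RRe_real// gtr0_real.
set r := complex.Re e in er eE.
have [n0 n0P] : exists n0, forall n, (n0 <= n)%N -> rnorm (u n - l : hilb) < r / 2.
  have [|n0 n0P] := lP ((r / 2) ^+ 2); first by rewrite exprn_gt0 ?divr_gt0.
  exists n0 => n /n0P; rewrite -[rh_form _ _]rnorm_hilb_sqr.
  by rewrite ltr_pXn2r ?nnegrE ?rnorm_ge0// divr_ge0// ltW.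
(* One index for both estimates: [u k] is within r/2 of [l], and the ball around [u k] that belongs
   to the filter has radius at most r/2. *)
pose k := maxn n0 (Num.bound (2 / r)).
apply: filterS (uF k) => y; rewrite -ball_normE /= => yk.
rewrite eE -rnormE ltcR -(subrKA (u k)).
rewrite (le_lt_trans (rnormD _ _))// (splitr r) ltrD//.
  by rewrite -rnormN opprB n0P// leq_maxl.
rewrite -ltcR rnormE; apply: (lt_le_trans yk).
rewrite lecR -[r / 2]invrK lef_pV2 ?posrE ?invr_gt0 ?divr_gt0// invf_div.
apply: ltW; apply: (lt_le_trans (archi_boundP _)); first by rewrite divr_ge0// ltW.
by rewrite ler_nat (leq_trans (leq_maxr n0 _)).
Qed.

HB.instance Definition _ := Uniform_isComplete.Build hilb hilb_complete.

Definition hilb_dot (u v : hilb) : R[i] := cform N u v.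

Fact hilb_dot_addl (v : hilb) : zmod_morphism (hilb_dot ^~ v).
Proof.
move=> x y; rewrite -scaleN1r; have := cformDl N x (-1 *: (y : rh_sort X)) v.
by rewrite cformZl mulN1r.
Qed.

Fact hilb_dotC (u v : hilb) : hilb_dot u v = (-1) ^+ false * (hilb_dot v u)^*.
Proof. by rewrite mul1r; symmetry; exact: cformC. Qed.

Fact hilb_dot_addr (u : hilb) : zmod_morphism (hilb_dot u).
Proof.
by move=> x y; rewrite !(hilb_dotC u) !mul1r hilb_dot_addl rmorphB.
Qed.

Fact hilb_dot_scalel (v : hilb) : scalable_for *%R (hilb_dot ^~ v).
Proof. by move=> a x; exact: cformZl. Qed.

Fact hilb_dot_scaler (u : hilb) :
  scalable_for ((@Num.conj R[i]) \; *%R) (hilb_dot u).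
Proof.
by move=> a x; rewrite !(hilb_dotC u) !mul1r hilb_dot_scalel rmorphM.
Qed.

HB.instance Definition _ := isBilinear.Build R[i] hilb hilb R[i]
  *%R ((@Num.conj R[i]) \; *%R) hilb_dot
  hilb_dot_addl hilb_dot_addr hilb_dot_scalel hilb_dot_scaler.

HB.instance Definition _ := isHermitianSesquilinear.Build R[i] hilb false
  (@Num.conj R[i]) hilb_dot hilb_dotC.

Fact hilb_dot_gt0 (u : hilb) : u != 0 -> 0 < hilb_dot u u.
Proof.
move=> u0; rewrite [hilb_dot u u]cformvv ltcR lt_def qf_ge0 andbT.
by apply: contra_neq u0 => /rh_definite.
Qed.

HB.instance Definition _ := isDotProduct.Build R[i] hilb
  hilb_dot hilb_dot_gt0.

Fact hilb_dotE (u : hilb) : hilb_dot u u = `|u| ^+ 2.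
Proof.
rewrite [hilb_dot u u]cformvv -rnormE -rmorphXn /= -[in LHS](sqr_sqrtr (qf_ge0 N u)).
by [].
Qed.

HB.instance Definition _ := isHilbert.Build R hilb hilb_dotE.

Lemma hdot_hilb (u v : hilb) : hdot u v = cform (rh_form X) u v.
Proof. by []. Qed.

End HilbertSpaceOfForm.

(** * The dual of a quadratic form *)

Lemma real_cauchy_cvg (R : realType) (u : nat -> R) :
  (forall e, 0 < e -> exists n0, forall m n, (n0 <= m)%N -> (n0 <= n)%N ->
    `|u m - u n| < e) -> cvg (u @ \oo).
Proof.
move=> uc; apply/cauchy_cvgP/cauchy_exP => e e0.
have [n0 n0P] := uc e e0; exists (u n0); exists n0 => // n /= n0n.
by rewrite -ball_normE /=; exact: n0P.
Qed.

Lemma mulC_invC (R : realType) (r : R) (z : R[i]) : r != 0 ->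
  r%:C%C * (r^-1%:C%C * z) = z.
Proof. by move=> r0; rewrite mulrA -rmorphM /= mulfV// mul1r. Qed.

Section QDual.
Context {R : realType} {V : lmodType R[i]} (q : qform V).

(** Scaling [v] shows that this bound is equivalent to |f v|^2 <= c q v. It involves no division,
    and it forces [f] to vanish where [q] does, so the null space of [q] is never quotiented out. *)
Definition qdual_pred : {pred V -> R[i]^o} :=
  [pred f : V -> R[i]^o | `[< (forall a u v, f (a *: u + v) = a * f u + f v) /\
    exists c : R, forall v, 2 * complex.Re (f v) <= c + q v >]].

Record qdual := QDual {
  qdual_fun :> V -> R[i]^o;
  qdual_subproof : qdual_fun \in qdual_pred
}.

Lemma qdual_predP (f : V -> R[i]^o) : reflect
  ((forall a u v, f (a *: u + v) = a * f u + f v) /\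
    exists c : R, forall v, 2 * complex.Re (f v) <= c + q v)
  (f \in qdual_pred).
Proof. exact: asboolP. Qed.

Fact qdual_submod_closed : submod_closed qdual_pred.
Proof.
split=> [|a f g /qdual_predP[fl [c fc]] /qdual_predP[gl [d gd]]].
  apply/qdual_predP; split=> [b x y|]; first by rewrite /= mulr0 addr0.
  by exists 0 => v /=; rewrite mulr0 add0r qf_ge0.
have lin : forall b u v, (a *: f + g) (b *: u + v) = b * (a *: f + g) u + (a *: f + g) v.
  move=> b u v; rewrite -![(a *: f + g) _]/(a * f _ + g _) fl gl.
  ring.
apply/qdual_predP; split=> //.
(* [f] is tested at a v / r and [g] at v / 2; with this [r] each of the two quadratic terms is at
   most q v / 2. *)
pose r := 2 * (rnorm a ^+ 2 + 1); have r0 : 0 < r.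
  by rewrite mulr_gt0// ltr_wpDl ?sqr_ge0.
have fZ b u : f (b *: u) = b * f u.
  have := fl b u 0; rewrite addr0 => ->.
  by have := fl 1 0 0; rewrite scale1r addr0 mul1r -[LHS]addr0 => /addrI <-; rewrite addr0.
have gZ b u : g (b *: u) = b * g u.
  have := gl b u 0; rewrite addr0 => ->.
  by have := gl 1 0 0; rewrite scale1r addr0 mul1r -[LHS]addr0 => /addrI <-; rewrite addr0.
exists (r * c + 2 * d) => v.
rewrite -[(a *: f + g) _]/(a * f _ + g _) ReD mulrDr.
have -> : a * f v = r%:C%C * f (r^-1%:C%C *: (a *: v)).
  by rewrite !fZ (mulC_invC _ (lt0r_neq0 r0)).
have -> : g v = 2%:C%C * g (2^-1%:C%C *: v).
  by rewrite gZ mulC_invC.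
rewrite !Re_real_mul.
have := gd (2^-1%:C%C *: v); have := fc (r^-1%:C%C *: (a *: v)).
rewrite !qf_realZ qfZ => h1 h2.
have : r * (2 * complex.Re (f (r^-1%:C%C *: (a *: v)))) <=
   r * (c + r^-1 ^+ 2 * (rnorm a ^+ 2 * q v)) by rewrite ler_wpM2l// ltW.
have : r * (r^-1 ^+ 2 * (rnorm a ^+ 2 * q v)) <= 2^-1 * q v.
  rewrite !mulrA; apply: (ler_wpM2r (qf_ge0 q v)).
  rewrite (_ : _ * rnorm a = rnorm a ^+ 2 / r); last by field; rewrite gt_eqF.
  by rewrite ler_pdivrMr// /r; have := sqr_ge0 (rnorm a); lra.
by rewrite mulrDr; lra.
Qed.

HB.instance Definition _ := GRing.isSubmodClosed.Build R[i] (V -> R[i]^o)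
  qdual_pred qdual_submod_closed.

HB.instance Definition _ := [isSub for qdual_fun].
HB.instance Definition _ := [Choice of qdual by <:].
HB.instance Definition _ := [SubChoice_isSubLmodule of qdual by <:].

Lemma qdual_ext (f g : qdual) : f =1 g -> f = g.
Proof. by move=> fg; apply/val_inj/funext. Qed.

Lemma qdualP (f : qdual) a u v : f (a *: u + v) = a * f u + f v.
Proof. by have /qdual_predP[] := qdual_subproof f. Qed.

Lemma qdual0 (f : qdual) : f 0 = 0.
Proof. by have := qdualP f (-1) 0 0; rewrite scaler0 addr0 mulN1r addNr. Qed.

Lemma qdualD (f : qdual) u v : f (u + v) = f u + f v.
Proof. by have := qdualP f 1 u v; rewrite scale1r mul1r. Qed.

Lemma qdualZ (f : qdual) a u : f (a *: u) = a * f u.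
Proof. by have := qdualP f a u 0; rewrite qdual0 !addr0. Qed.

Lemma qdualN (f : qdual) u : f (- u) = - f u.
Proof. by rewrite -scaleN1r qdualZ mulN1r. Qed.

Lemma qdual_sum (f : qdual) I (r : seq I) (E : I -> V) :
  f (\sum_(i <- r) E i) = \sum_(i <- r) f (E i).
Proof. by apply: (big_morph _ (qdualD f) (qdual0 f)). Qed.

Lemma qdualDE (f g : qdual) v : (f + g) v = f v + g v. Proof. by []. Qed.
Lemma qdualNE (f : qdual) v : (- f) v = - f v. Proof. by []. Qed.
Lemma qdualZE a (f : qdual) v : (a *: f) v = a * f v. Proof. by []. Qed.

(* The square of the dual norm, written without square roots or quotients: in
   this form the parallelogram law follows by testing at [v + u] and [v - u]. *)
Definition dual_norm (f : qdual) : R := sup (range (fun v => 2 * complex.Re (f v) - q v)).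

Lemma dual_norm_ub (f : qdual) v : 2 * complex.Re (f v) - q v <= dual_norm f.
Proof.
apply: ub_le_sup; last by exists v.
have /qdual_predP[_ [c fc]] := qdual_subproof f.
by exists c => _ [w _ <-]; rewrite lerBlDr.
Qed.

Lemma dual_norm_le (f : qdual) c :
  (forall v, 2 * complex.Re (f v) - q v <= c) -> dual_norm f <= c.
Proof.
move=> fc; apply: ge_sup; first by exists (2 * complex.Re (f 0) - q 0), 0.
by move=> _ [v _ <-].
Qed.

Fact dual_norm_ge0 (f : qdual) : 0 <= dual_norm f.
Proof. by have := dual_norm_ub f 0; rewrite qdual0 qf0 mulr0 subr0. Qed.

Let dual_norm2 (f : qdual) : dual_norm (f + f) <= 4 * dual_norm f.
Proof.
apply: dual_norm_le => v; have := dual_norm_ub f (2^-1%:C%C *: v).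
by rewrite qdualZ Re_real_mul qf_realZ qdualDE ReD; lra.
Qed.

Let dual_norm_par_le (f g : qdual) :
  2 * (dual_norm f + dual_norm g) <= dual_norm (f + g) + dual_norm (f - g).
Proof.
suff H u : dual_norm f <=
    (dual_norm (f + g) + dual_norm (f - g)) / 2 - (2 * complex.Re (g u) - q u).
  suff : dual_norm g <= (dual_norm (f + g) + dual_norm (f - g)) / 2 - dual_norm f.
    by lra.
  by apply: dual_norm_le => u; have := H u; lra.
apply: dual_norm_le => v; have := dual_norm_ub (f + g) (v + u).
have := dual_norm_ub (f - g) (v - u); have := qf_par q v u.
by rewrite !qdualDE !qdualNE !qdualD !qdualN !(ReD, ReN); lra.
Qed.

(** The inequality just proved, applied to [f + g] and [f - g], is its own converse, since doubling
    a functional multiplies [dual_norm] by at most 4. *)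
Fact dual_norm_par (f g : qdual) :
  dual_norm (f + g) + dual_norm (f - g) = 2 * (dual_norm f + dual_norm g).
Proof.
apply/eqP; rewrite eq_le dual_norm_par_le andbT.
have := dual_norm_par_le (f + g) (f - g).
rewrite opprB addrACA subrr addr0 [f + g + _]addrC addrA subrK.
by have := dual_norm2 f; have := dual_norm2 g; lra.
Qed.

Fact dual_norm_contract a (f : qdual) : rnorm a <= 1 ->
  dual_norm (a *: f) <= dual_norm f.
Proof.
move=> a1; apply: dual_norm_le => v; rewrite qdualZE -qdualZ.
apply: le_trans (dual_norm_ub f (a *: v)); rewrite lerD2l lerN2.
exact: qf_contract.
Qed.

Definition dual_form : qform qdual :=
  QForm dual_norm_ge0 dual_norm_par dual_norm_contract.

Lemma dual_formE f : dual_form f = dual_norm f. Proof. by []. Qed.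

Lemma dual_CS (f : qdual) v : complex.Re (f v) ^+ 2 <= dual_form f * q v.
Proof.
apply: discriminant_le; rewrite ?qf_ge0// => t.
have := dual_norm_ub f (t%:C%C *: v); rewrite qdualZ Re_real_mul qf_realZ.
by rewrite -[dual_form f]/(dual_norm f); lra.
Qed.

Lemma dual_definite (f : qdual) : dual_form f = 0 -> f = 0.
Proof.
move=> f0; have Re0 v : complex.Re (f v) = 0.
  have := dual_CS f v; rewrite f0 mul0r => h; apply/eqP.
  by rewrite -sqrf_eq0 eq_le h sqr_ge0.
apply: qdual_ext => v; apply: complex_eqRe; first by rewrite Re0.
by rewrite -qdualZ Re0 mulr0.
Qed.

Lemma dual_complete (u : nat -> qdual) :
  q_cauchy dual_form u -> exists l, q_converges dual_form u l.
Proof.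
move=> uc.
have cvRe v : cvg ((fun n => complex.Re (u n v)) @ \oo).
  apply: real_cauchy_cvg => e e0.
  (* Cauchy-Schwarz turns the Cauchy condition of the form into a pointwise one; the [+ 1] covers
     [q v = 0]. *)
  have [|n0 n0P] := uc (e ^+ 2 / (q v + 1)).
    by rewrite divr_gt0 ?exprn_gt0// ltr_wpDl ?qf_ge0.
  exists n0 => m n m0 n0n.
  rewrite -(ltr_pXn2r (n := 2))// ?nnegrE ?(ltW e0)// real_normK ?num_real//.
  have -> : complex.Re (u m v) - complex.Re (u n v) = complex.Re ((u m - u n) v).
    by rewrite qdualDE qdualNE ReD ReN.
  apply: (le_lt_trans (dual_CS _ _)).
  have := n0P m n m0 n0n; rewrite ltr_pdivlMr; last by rewrite ltr_wpDl ?qf_ge0.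
  apply: le_lt_trans; rewrite ler_wpM2l ?qf_ge0// lerDl//.
have cvIm v : cvg ((fun n => complex.Im (u n v)) @ \oo).
  rewrite (_ : (fun n => _) = (fun n => - complex.Re (u n ('i%C *: v)))).
    by apply: is_cvgN; exact: cvRe.
  by apply/funext => n; rewrite qdualZ Re_i_mul opprK.
pose LR v := lim ((fun n => complex.Re (u n v)) @ \oo).
pose LI v := lim ((fun n => complex.Im (u n v)) @ \oo).
pose f : V -> R[i]^o := fun v => (LR v +i* LI v)%C.
have flin a v w : f (a *: v + w) = a * f v + f w.
  case: a => x y; apply/eqP; rewrite eq_complex /=; apply/andP; split; apply/eqP.
    apply/cvg_lim => //.
    rewrite (_ : (fun n => _) = (fun n => x * complex.Re (u n v)
        - y * complex.Im (u n v) + complex.Re (u n w))).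
      apply: cvgD (cvRe w); apply: cvgB; apply: cvgMr; [exact: cvRe|exact: cvIm].
    by apply/funext => n; rewrite qdualP; case: (u n v) (u n w) => ? ? [].
  apply/cvg_lim => //.
  rewrite (_ : (fun n => _) = (fun n => x * complex.Im (u n v)
      + y * complex.Re (u n v) + complex.Im (u n w))).
    by apply: cvgD (cvIm w); apply: cvgD; apply: cvgMr; [exact: cvIm|exact: cvRe].
  by apply/funext => n; rewrite qdualP; case: (u n v) (u n w) => ? ? [].
(* Being a family of pointwise inequalities, the Cauchy estimate survives m -> oo for fixed n. It
   yields both the boundedness of the limit and the convergence to it. *)
have near e : 0 < e -> exists n0, forall n, (n0 <= n)%N ->
    forall v, 2 * (LR v - complex.Re (u n v)) - q v <= e.
  move=> e0; have [n0 n0P] := uc e e0; exists n0 => n n0n v.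
  have : LR v <= complex.Re (u n v) + (e + q v) / 2.
    apply: limr_le; first exact: cvRe.
    exists n0 => // m /= n0m.
    have := dual_norm_ub (u m - u n) v; have := n0P m n n0m n0n.
    rewrite qdualDE qdualNE ReD ReN -[dual_form _]/(dual_norm _) /=; lra.
  by lra.
have fD : f \in qdual_pred.
  apply/qdual_predP; split=> //.
  have [n0 n0P] := near 1 ltr01.
  exists (2 * (1 + dual_norm (u n0))) => v.
  (* At v / 2 each of the two bounds costs q v / 4; doubling their sum gives exactly q v. *)
  have := n0P n0 (leqnn _) (2^-1%:C%C *: v).
  have := dual_norm_ub (u n0) (2^-1%:C%C *: v).
  have -> : complex.Re (f v) = 2 * LR (2^-1%:C%C *: v).
    have vE : 1 *: (2^-1%:C%C *: v) + 2^-1%:C%C *: v = v.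
      by rewrite scale1r -scalerDl -rmorphD /= -[2^-1]mul1r -splitr scale1r.
    have := congr1 (@complex.Re R) (flin 1 (2^-1%:C%C *: v) (2^-1%:C%C *: v)).
    by rewrite vE mul1r /= => ->; lra.
  by rewrite qf_realZ; lra.
exists (QDual fD) => e e0; have [n0 n0P] := near (e / 2) (divr_gt0 e0 (ltr0Sn R 1)).
exists n0 => n n0n; rewrite -qfN opprB.
apply: (@le_lt_trans _ _ (e / 2)); last by lra.
apply: dual_norm_le => v; rewrite qdualDE qdualNE ReD ReN.
exact: n0P.
Qed.

Definition dual_rawHilbert : rawHilbert R :=
  RawHilbert dual_definite dual_complete.

Fact riesz_subproof v : (fun w => cform q w v) \in qdual_pred.
Proof.
apply/qdual_predP; split=> [a x y|]; first by rewrite cformDl cformZl.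
by exists (q v) => w; rewrite Re_cform addrC rform_le.
Qed.

Definition riesz v : qdual := QDual (riesz_subproof v).

Lemma rieszE v w : riesz v w = cform q w v. Proof. by []. Qed.

Lemma rieszN v : riesz (- v) = - riesz v.
Proof.
by apply: qdual_ext => w; rewrite qdualNE !rieszE cformNr.
Qed.

(** Completing the square: the test vector [w] is moved to [w - v]. *)
Let dual_norm_riesz_le f v :
  dual_norm (f + riesz v) <= dual_norm f + 2 * complex.Re (f v) + q v.
Proof.
apply: dual_norm_le => w; have := dual_norm_ub f (w - v).
by rewrite qdualDE qdualD qdualN rieszE !ReD ReN Re_cform qfB; lra.
Qed.

(** The previous bound for [- v], and for [v] starting from [f - riesz v], are converse to each
    other. The formula is exact without [f] being represented by a vector; reproduction and density
    both follow from it. *)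
Lemma dual_form_riesz f v :
  dual_form (f - riesz v) = dual_form f - 2 * complex.Re (f v) + q v.
Proof.
rewrite !dual_formE; apply/eqP; rewrite eq_le -rieszN; apply/andP; split.
  by have := dual_norm_riesz_le f (- v); rewrite qdualN ReN qfN; lra.
have := dual_norm_riesz_le (f + riesz (- v)) v.
rewrite qdualDE ReD rieszN qdualNE rieszE ReN Re_cform rformvv addrNK; lra.
Qed.

Lemma dual_form_rieszD f v :
  dual_form (f + riesz v) = dual_form f + 2 * complex.Re (f v) + q v.
Proof.
rewrite -[v in LHS]opprK rieszN dual_form_riesz qdualN ReN qfN; lra.
Qed.

Lemma dual_form_rieszE v : dual_form (riesz v) = q v.
Proof.
have := dual_form_riesz (riesz v) v; rewrite subrr qf0 rieszE Re_cform rformvv.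
lra.
Qed.

(** Polarization: the forms of [f + riesz v] and [f - riesz v] differ by 4 Re (f v). *)
Lemma riesz_reproducing (f : qdual) v : cform dual_form f (riesz v) = f v.
Proof.
have E g : rform dual_form g (riesz v) = complex.Re (g v).
  by rewrite /rform dual_form_riesz dual_form_rieszD; field.
apply: complex_eqRe; first by rewrite Re_cform E.
by rewrite -cformZl Re_cform E.
Qed.

(** The form at [f - riesz v] is the gap between the supremum defining [dual_norm f] and its
    competitor at [v], so near-maximizers represent [f] approximately. *)
Lemma riesz_dense (f : qdual) e : 0 < e -> exists v, dual_form (f - riesz v) < e.
Proof.
move=> e0; have [|_ [v _ <-] fv] := @sup_adherent _
    (range (fun v => 2 * complex.Re (f v) - q v)) e e0.
  split; first by exists (2 * complex.Re (f 0) - q 0), 0.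
  by exists (dual_norm f) => _ [v _ <-]; exact: dual_norm_ub.
by exists v; rewrite dual_form_riesz -[dual_form f]/(sup _); lra.
Qed.

End QDual.

(** * A Hahn-Banach theorem on finite families *)

Section SequenceMonoid.
Context {T : eqType}.
Implicit Types (a b : seq T).

Definition srep n a : seq T := flatten (nseq n a).

Lemma srepS n a : srep n.+1 a = a ++ srep n a. Proof. by []. Qed.

Lemma srepD m n a : srep (m + n) a = srep m a ++ srep n a.
Proof. by rewrite /srep nseqD flatten_cat. Qed.

Lemma srep_srep m n a : srep m (srep n a) = srep (m * n) a.
Proof. by elim: m => // m IH; rewrite srepS IH mulSn srepD. Qed.

Lemma perm_srep_cat n a b : perm_eq (srep n (a ++ b)) (srep n a ++ srep n b).
Proof.
elim: n => // n IH; rewrite !srepS -!catA perm_cat2l.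
by rewrite perm_sym perm_catCA perm_cat2l perm_sym.
Qed.

End SequenceMonoid.

Section SequenceHahnBanach.
Context {R : realType} {T : eqType} (le : seq T -> seq T -> Prop).
Implicit Types (a b c x y z : seq T) (p : seq T -> R).

Hypothesis le_perm : forall a b, perm_eq a b -> le a b.
Hypothesis le_cat : forall a b c, le a b -> le (a ++ c) (b ++ c).
Hypothesis le_catr : forall a b, le b (a ++ b).

(** Families form a commutative monoid up to permutation, without real multiples; homogeneity is
    therefore asked for repetitions. *)
Record sgauge p : Prop := Sgauge {
  sg_sub : forall a b, p (a ++ b) <= p a + p b;
  sg_mono : forall a b, le a b -> p a <= p b;
  sg_srep : forall n a, p (srep n a) = n%:R * p a
}.

Section Gauge.
Context p (pg : sgauge p).

Lemma sg_perm a b : perm_eq a b -> p a = p b.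
Proof.
move=> ab; apply/eqP; rewrite eq_le; apply/andP.
by split; apply: (sg_mono pg); apply: le_perm; rewrite // perm_sym.
Qed.

Lemma sg_nil : p [::] = 0.
Proof. by have := sg_srep pg 0 [::]; rewrite mul0r. Qed.

Lemma sg_ge0 a : 0 <= p a.
Proof. by rewrite -sg_nil (sg_mono pg)// -[X in le _ X]cats0; exact: le_catr. Qed.

Context y.

Let shift x n := p (x ++ srep n y) - n%:R * p y.
(** By subadditivity the differences decrease in [n]: this is the renormalized value of [p] far out
    in the direction [y]. It lies below [p], and its term [n = 1] gives the superadditivity
    [sg_shift_y]. *)
Definition sg_shift x : R := inf (range (shift x)).

Let shift_ge0 x n : 0 <= shift x n.
Proof. by rewrite subr_ge0 -(sg_srep pg) (sg_mono pg). Qed.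

Lemma sg_shift_lb x n : sg_shift x <= p (x ++ srep n y) - n%:R * p y.
Proof.
by apply: ge_inf; [exists 0 => _ [m _ <-]; exact: shift_ge0 | exists n].
Qed.

Lemma le_sg_shift x (d : R) :
  (forall n, d <= p (x ++ srep n y) - n%:R * p y) -> d <= sg_shift x.
Proof.
by move=> dn; apply: lb_le_inf; [exists (shift x 0); exists 0%N | move=> _ [m _ <-]; exact: dn].
Qed.

Lemma sg_shift_le x : sg_shift x <= p x.
Proof. by have := sg_shift_lb x 0; rewrite cats0 mul0r subr0. Qed.

Lemma sg_shift_y x : sg_shift x + p y <= p (x ++ y).
Proof. by have := sg_shift_lb x 1; rewrite /srep /= cats0 mul1r; lra. Qed.

Let sg_shift_sub a b : sg_shift (a ++ b) <= sg_shift a + sg_shift b.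
Proof.
rewrite -lerBlDr; apply: le_sg_shift => n; rewrite lerBlDr addrC -lerBlDr.
apply: le_sg_shift => m; rewrite lerBlDr; apply: (le_trans (sg_shift_lb _ (n + m))).
have -> : p ((a ++ b) ++ srep (n + m) y) = p ((a ++ srep n y) ++ (b ++ srep m y)).
  by apply: sg_perm; rewrite srepD -!catA perm_cat2l perm_catCA.
by have := sg_sub pg (a ++ srep n y) (b ++ srep m y); rewrite natrD; lra.
Qed.

Let sg_shift_srep n a : sg_shift (srep n a) = n%:R * sg_shift a.
Proof.
apply/eqP; rewrite eq_le; apply/andP; split.
  elim: n => [|n IH]; first by have := sg_shift_le [::]; rewrite sg_nil mul0r.
  rewrite srepS -natr1 mulrDl mul1r addrC.
  by apply: (le_trans (sg_shift_sub _ _)); rewrite lerD2l.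
apply: le_sg_shift => m.
case: n => [|n]; first by rewrite mul0r; exact: shift_ge0.
(* [n.+1] copies of [a ++ srep m y] contain [n.+1 * m] copies of [y]; the surplus [n * m] is split
   off by subadditivity. *)
have := sg_shift_lb a m; rewrite -(ler_pM2l (ltr0Sn R n)); move/le_trans; apply.
rewrite mulrBr -(sg_srep pg n.+1 (a ++ _)) (sg_perm (perm_srep_cat _ _ _)) srep_srep.
rewrite mulSn srepD catA.
have := sg_sub pg (srep n.+1 a ++ srep m y) (srep (n * m) y).
by rewrite (sg_srep pg (n * m)) natrM -natr1; lra.
Qed.

Lemma sg_shift_gauge : sgauge sg_shift.
Proof.
split=> // a b ab; apply: le_sg_shift => n; apply: (le_trans (sg_shift_lb _ n)).
by rewrite lerD2r; apply: (sg_mono pg); exact: le_cat.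
Qed.

Lemma sg_shift_additive z s : (forall x, p x + s <= p (x ++ z)) ->
  forall x, sg_shift x + s <= sg_shift (x ++ z).
Proof.
move=> pz x; apply: le_sg_shift => n.
have -> : p ((x ++ z) ++ srep n y) = p ((x ++ srep n y) ++ z).
  by apply: sg_perm; rewrite -!catA perm_cat2l perm_catC.
by have := pz (x ++ srep n y); have := sg_shift_lb x n; lra.
Qed.

End Gauge.

(* Hahn-Banach without subtraction: a minimal monotone sublinear gauge is
   additive, because it cannot decrease under [sg_shift]. *)
Lemma seq_hahn_banach U z : sgauge U ->
  exists p, [/\ sgauge p, forall a b, p (a ++ b) = p a + p b,
    forall a, p a <= U a & U z <= p z].
Proof.
move=> Ug.
(* Superadditivity along [z] passes to infima of chains and to [sg_shift]; at [x = [::]] it returns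
   U z <= p z. *)
pose good p := [/\ sgauge p, forall a, p a <= U a & forall x, p x + U z <= p (x ++ z)].
have good_base : good (sg_shift U z).
  split; first exact: sg_shift_gauge; first by move=> a; exact: sg_shift_le.
  move=> x; apply: le_sg_shift => n; have := sg_shift_lb Ug z x n.+1.
  by rewrite srepS -catA -natr1; lra.
pose S := {p | good p}.
(* Smaller gauges are larger for [Rl], so the maximal element given by Zorn is a minimal gauge. *)
pose Rl (p q : S) := `[< forall x, sval q x <= sval p x >].
have [||||p pmin] := @Zorn S Rl.
- by move=> p; apply/asboolP.
- by move=> p q r /asboolP pq /asboolP qr; apply/asboolP => x; exact: le_trans (qr x) (pq x).
- move=> [p pg] [q qg] /asboolP /= pq /asboolP /= qp.
  have pqE : p = q by apply/funext => x; apply/eqP; rewrite eq_le pq qp.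
  by move: pg; rewrite pqE => pg; congr exist; exact: Prop_irrelevance.
- move=> A Atot; have [[p0 Ap0]|A0] := pselect (exists r : S, A r); last first.
    by exists (exist _ _ good_base) => s As; exfalso; apply: A0; exists s.
  pose m x := inf [set sval r x | r in A].
  have m_lb (p : S) x : A p -> m x <= sval p x.
    move=> Ap; apply: ge_inf; last by exists p.
    by exists 0 => _ [q _ <-]; have [qg _ _] := svalP q; exact: sg_ge0.
  have le_m x d : (forall r : S, A r -> d <= sval r x) -> d <= m x.
    by move=> h; apply: lb_le_inf; [exists (sval p0 x), p0 | move=> _ [q Aq <-]; exact: h].
  suff mg : good m by exists (exist _ m mg) => s As; apply/asboolP => x; exact: m_lb.
  split; last 2 first.
  - by move=> a; apply: (le_trans (m_lb p0 a Ap0)); have [_ ->] := svalP p0.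
  - move=> x; apply: (le_m) => p Ap; have [_ _ pz] := svalP p.
    by have := m_lb p x Ap; have := pz x; lra.
  split.
  - move=> a b; rewrite -lerBlDr; apply: (le_m) => p Ap.
    rewrite lerBlDr addrC -lerBlDr; apply: (le_m) => q Aq; rewrite lerBlDr.
    have [pg _ _] := svalP p; have [qg _ _] := svalP q.
    (* Gauges chosen separately for [a] and [b] are comparable in the chain; the smaller one serves
       both. *)
    have [/asboolP pq|/asboolP qp] := Atot p q Ap Aq.
      apply: (le_trans (m_lb q _ Aq)); apply: (le_trans (sg_sub qg _ _)).
      by rewrite addrC lerD2l.
    apply: (le_trans (m_lb p _ Ap)); apply: (le_trans (sg_sub pg _ _)).
    by rewrite addrC lerD2r.
  - move=> a b ab; apply: (le_m) => p Ap; apply: (le_trans (m_lb p a Ap)).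
    by have [pg _ _] := svalP p; exact: sg_mono.
  - move=> n a; apply/eqP; rewrite eq_le; apply/andP; split.
      case: n => [|n]; first by rewrite mul0r -(sg_nil (let: And3 g _ _ := svalP p0 in g)) m_lb.
      rewrite -ler_pdivrMl//; apply: (le_m) => p Ap; rewrite ler_pdivrMl//.
      by have [pg _ _] := svalP p; rewrite -(sg_srep pg); exact: m_lb.
    apply: (le_m) => p Ap; have [pg _ _] := svalP p; rewrite (sg_srep pg).
    by rewrite ler_wpM2l// m_lb.
have [pg pU pz] := svalP p; exists (sval p); split=> //; last first.
  by have := pz [::]; rewrite (sg_nil pg) add0r.
move=> a b; apply/eqP; rewrite eq_le (sg_sub pg) /=.
have gs : good (sg_shift (sval p) b).
  split; first exact: sg_shift_gauge; last exact: sg_shift_additive.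
  by move=> x; apply: (le_trans _ (pU x)); exact: sg_shift_le.
have E : exist _ _ gs = p.
  by apply: pmin; apply/asboolP => x; exact: sg_shift_le.
have pE : sval p a = sg_shift (sval p) b a by rewrite -[in LHS]E.
by rewrite pE; exact: sg_shift_y.
Qed.

End SequenceHahnBanach.

(** * Scalar contractions of families *)

Lemma big_ord_pad (V : nmodType) (g : nat -> V) (M N : nat) : (M <= N)%N ->
  (forall i, (M <= i)%N -> g i = 0) -> \sum_(i < N) g i = \sum_(i < M) g i.
Proof.
move=> MN g0; rewrite (big_ord_widen N g MN) [LHS](bigID (fun i : 'I_N => (i < M)%N)) /=.
by rewrite [X in _ + X]big1 ?addr0// => i; rewrite -leqNgt; exact: g0.
Qed.

Lemma big_ord_delta (K : pzRingType) (V : lmodType K) (n j0 : nat) (g : nat -> V) :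
  (j0 < n)%N -> \sum_(j < n) (j0 == j)%:R *: g j = g j0.
Proof.
move=> j0n; rewrite (bigD1 (Ordinal j0n)) //= eqxx scale1r big1 ?addr0// => j.
by rewrite -val_eqE /= eq_sym => /negPf ->; rewrite scale0r.
Qed.

Section Contractions.
Context {R : realType}.
Implicit Types T S : nat -> nat -> R[i].

Local Notation sq z := (rnorm (z : R[i]) ^+ 2).

(* Matrices are indexed by [nat]; only entries within the stated bounds matter. *)
Definition l2contr (m n : nat) T := forall v : nat -> R[i],
  \sum_(i < m) sq (\sum_(j < n) T i j * v j) <= \sum_(j < n) sq (v j).

Lemma l2contr_mul m n p T S : l2contr m n T -> l2contr n p S ->
  l2contr m p (fun i j => \sum_(l < n) T i l * S l j).
Proof.
move=> Tc Sc v; apply: le_trans (Sc v).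
apply: le_trans (Tc (fun l => \sum_(j < p) S l j * v j)).
apply: ler_sum => i _; rewrite le_eqVlt; apply/orP; left; apply/eqP.
congr (rnorm _ ^+ 2); under eq_bigr => j _ do rewrite mulr_suml.
rewrite exchange_big /=; apply: eq_bigr => l _; rewrite mulr_sumr.
by apply: eq_bigr => j _; rewrite mulrA.
Qed.

Context {V : lmodType R[i]}.
Implicit Types z w a b c : seq V.

Definition con z w := exists2 T, l2contr (size z) (size w) T &
  forall i, (i < size z)%N -> z`_i = \sum_(j < size w) T i j *: w`_j.

Lemma con_trans w z y : con z w -> con w y -> con z y.
Proof.
move=> [T Tc zT] [S Sc wS]; exists (fun i j => \sum_(l < size w) T i l * S l j).
  exact: l2contr_mul.
move=> i iz; rewrite zT//; under [RHS]eq_bigr do rewrite scaler_suml.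
rewrite exchange_big /=; apply: eq_bigr => l _; rewrite wS// scaler_sumr.
by apply: eq_bigr => j _; rewrite scalerA.
Qed.

(** Distinct indices make this a coordinate projection; permutations and suffixes are both special
    cases. *)
Lemma con_select w (s : seq nat) : uniq s -> all (ltn^~ (size w)) s ->
  con [seq w`_i | i <- s] w.
Proof.
move=> us sw; exists (fun i j => (nth 0%N s i == j)%:R); last first.
  move=> i; rewrite size_map => i_s; rewrite (nth_map 0%N)// big_ord_delta//.
  by have /allP := sw; apply; exact: mem_nth.
move=> v; rewrite size_map.
have -> : \sum_(i < size s) sq (\sum_(j < size w) (nth 0%N s i == j)%:R * v j) =
    \sum_(l <- s) sq (v l).
  rewrite [RHS](big_nth 0%N) big_mkord; apply: eq_bigr => i _.
  rewrite -(@big_ord_delta _ R[i]^o (size w) _ v)//.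
  by have /allP := sw; apply; exact: mem_nth.
rewrite -(big_mkord xpredT (fun j => sq (v j))) /index_iota subn0.
have /(perm_big _) -> /= : perm_eq s [seq j <- iota 0 (size w) | j \in s].
  apply: uniq_perm => //; first by rewrite filter_uniq ?iota_uniq.
  move=> j; rewrite mem_filter mem_iota /= add0n.
  by case: (boolP (j \in s)) => //= /(allP sw) /= ->.
rewrite big_filter big_mkcond /=; apply: ler_sum => j _.
by case: ifP => // _; rewrite sqr_ge0.
Qed.

Lemma con_perm z w : perm_eq z w -> con z w.
Proof.
move=> /(perm_iotaP 0) [s sw ->]; apply: con_select.
  by rewrite (perm_uniq sw) iota_uniq.
by rewrite (perm_all _ sw); apply/allP => j; rewrite mem_iota.
Qed.

(** Extension of [T] by zero to a square matrix: matrix norms live on square matrices, so families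
    of different lengths are compared at a common size [N]. *)
Lemma con_pad z w (N : nat) : (size z <= N)%N -> (size w <= N)%N -> con z w ->
  exists2 T, l2contr N N T & forall i, z`_i = \sum_(j < N) T i j *: w`_j.
Proof.
move=> zN wN [T Tc TE].
pose S i j := if (i < size z)%N && (j < size w)%N then T i j else 0.
have Sz i j : (size z <= i)%N -> S i j = 0 by rewrite /S ltnNge => ->.
have Sw i j : (size w <= j)%N -> S i j = 0 by rewrite /S andbC ltnNge => ->.
exists S => [v|i].
  rewrite (big_ord_pad (g := fun i => sq (\sum_(j < N) S i j * v j)) zN); last first.
    by move=> i iz; rewrite big1 ?rnorm0 ?expr0n// => j _; rewrite Sz// mul0r.
  apply: (@le_trans _ _ (\sum_(j < size w) sq (v j))); last first.
    rewrite (big_ord_widen N (fun j => sq (v j)) wN).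
    rewrite [leRHS](bigID (fun j : 'I_N => (j < size w)%N)) /=.
    by rewrite lerDl sumr_ge0// => j _; rewrite sqr_ge0.
  rewrite (le_trans _ (Tc v))// le_eqVlt; apply/orP; left; apply/eqP.
  apply: eq_bigr => i _; rewrite (big_ord_pad (g := fun j => S i j * v j) wN).
    by congr (rnorm _ ^+ 2); apply: eq_bigr => j _; rewrite /S !ltn_ord.
  by move=> j wj; rewrite Sw// mul0r.
have [iz|iz] := ltnP i (size z); last first.
  by rewrite nth_default// big1// => j _; rewrite Sz// scale0r.
rewrite TE// (big_ord_pad (g := fun j => S i j *: w`_j) wN).
  by apply: eq_bigr => j _; rewrite /S iz ltn_ord.
by move=> j wj; rewrite Sw// scale0r.
Qed.

Lemma con_refl z : con z z.
Proof. exact: con_perm. Qed.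

Lemma con_catr a b : con b (a ++ b).
Proof.
have {1}-> : b = [seq (a ++ b)`_i | i <- iota (size a) (size b)].
  apply: (@eq_from_nth _ 0); first by rewrite size_map size_iota.
  move=> i ib; rewrite (nth_map 0%N) ?size_iota// nth_iota//.
  by rewrite nth_cat ltnNge leq_addr addKn.
apply: con_select; first exact: iota_uniq.
by apply/allP => j; rewrite mem_iota size_cat => /andP[].
Qed.

Lemma con_cat a b c d : con a b -> con c d -> con (a ++ c) (b ++ d).
Proof.
move=> [T Tc aT] [S Sc cS].
pose Q i j := if (i < size a)%N then (if (j < size b)%N then T i j else 0)
  else (if (j < size b)%N then 0 else S (i - size a)%N (j - size b)%N).
have QT (i : 'I_(size a)) (j : 'I_(size b)) : Q i j = T i j by rewrite /Q !ltn_ord.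
have Q0 (i : 'I_(size a)) (j : 'I_(size d)) : Q i (size b + j)%N = 0.
  by rewrite /Q ltn_ord ltnNge leq_addr.
have Q0' (i : 'I_(size c)) (j : 'I_(size b)) : Q (size a + i)%N j = 0.
  by rewrite /Q ltn_ord ltnNge leq_addr.
have QS (i : 'I_(size c)) (j : 'I_(size d)) : Q (size a + i)%N (size b + j)%N = S i j.
  by rewrite /Q ltnNge leq_addr /= ltnNge leq_addr /= !addKn.
exists Q => [v|i].
  rewrite !size_cat !big_split_ord /=; apply: lerD.
    rewrite (le_trans _ (Tc v))//; apply: ler_sum => i _; rewrite big_split_ord /=.
    rewrite [X in _ + X]big1 ?addr0; last by move=> j _; rewrite Q0 mul0r.
    by under eq_bigr do rewrite QT.
  rewrite (le_trans _ (Sc (fun j => v (size b + j)%N)))//.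
  apply: ler_sum => i _; rewrite big_split_ord /=.
  rewrite [X in X + _]big1 ?add0r; last by move=> j _; rewrite Q0' mul0r.
  by under eq_bigr do rewrite QS.
rewrite !size_cat big_split_ord /= nth_cat => iac.
case: ltnP => ia.
  rewrite [X in _ + X]big1 ?addr0; last by move=> j _; rewrite (Q0 (Ordinal ia)) scale0r.
  by rewrite aT//; apply: eq_bigr => j _; rewrite (QT (Ordinal ia)) nth_cat ltn_ord.
have ic : (i - size a < size c)%N by rewrite ltn_subLR.
have iE : i = (size a + Ordinal ic)%N by rewrite /= subnKC.
rewrite cS// [X in X + _]big1 ?add0r; last by move=> j _; rewrite {1}iE Q0' scale0r.
apply: eq_bigr => j _; rewrite [in RHS]iE QS nth_cat ltnNge leq_addr /=.
by rewrite addKn.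
Qed.

Lemma con_scale s z w : con z w -> con [seq s *: v | v <- z] [seq s *: v | v <- w].
Proof.
move=> [T Tc zT]; exists T; rewrite !size_map// => i iz.
rewrite (nth_map 0)// zT// scaler_sumr; apply: eq_bigr => j _.
by rewrite (nth_map 0)// !scalerA mulrC.
Qed.

(** The row with four entries 1/2 is a unit vector; four entries instead of two avoid the square
    root of 2. *)
Lemma con_half4 (u1 u2 u3 u4 : V) :
  con [:: 2^-1%:C%C *: (u1 + u2 + u3 + u4)] [:: u1; u2; u3; u4].
Proof.
exists (fun _ _ => 2^-1%:C%C) => [v|[|//] _] /=.
  rewrite !big_ord_recl !big_ord0 !addr0 !rnorm_sqr !ReD !ImD !Re_real_mul !Im_real_mul.
  have H (a b c d : R) : (2^-1 * a + (2^-1 * b + (2^-1 * c + 2^-1 * d))) ^+ 2 <=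
      a ^+ 2 + b ^+ 2 + c ^+ 2 + d ^+ 2.
    have := sqr_ge0 (a - b); have := sqr_ge0 (a - c); have := sqr_ge0 (a - d).
    have := sqr_ge0 (b - c); have := sqr_ge0 (b - d); have := sqr_ge0 (c - d).
    by lra.
  by apply: (le_trans (lerD (H _ _ _ _) (H _ _ _ _))); lra.
by rewrite !big_ord_recl big_ord0 /= addr0 !scalerDr !addrA.
Qed.

(** The matrix has orthonormal rows with entries 1/2 and -1/2, and its transpose serves in
    [con_butterflyV]. For an additive functional monotone under [con] the two together are the
    parallelogram law. *)
Lemma con_butterfly (u v : V) : con [:: u + v; u - v] [:: u; u; v; v].
Proof.
pose T (i j : nat) : R[i] := ((if (i == 1%N) && (1 < j)%N then - 2^-1 else 2^-1)%:C)%C.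
exists T => [x|].
  rewrite /= !big_ord_recl !big_ord0 !addr0 /T /= !rnorm_sqr !ReD !ImD !Re_real_mul !Im_real_mul.
  have H (a b c d : R) : (2^-1 * a + (2^-1 * b + (2^-1 * c + 2^-1 * d))) ^+ 2 +
      (2^-1 * a + (2^-1 * b + (- 2^-1 * c + - 2^-1 * d))) ^+ 2 <=
      a ^+ 2 + b ^+ 2 + c ^+ 2 + d ^+ 2.
    by have := sqr_ge0 (a - b); have := sqr_ge0 (c - d); lra.
  rewrite addrACA; apply: (le_trans (lerD (H _ _ _ _) (H _ _ _ _))); lra.
case=> [|[|//]] _ /=; rewrite !big_ord_recl big_ord0 /= /T /= addr0 addrA -scalerDr scale_halfD.
  by rewrite -scalerDr scale_halfD.
by rewrite rmorphN !scaleNr -opprD -scalerDr scale_halfD.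
Qed.

Lemma con_butterflyV (u v : V) : con [:: u; u; v; v] [:: u + v; u - v].
Proof.
pose T (i j : nat) : R[i] := ((if (1 < i)%N && (j == 1%N) then - 2^-1 else 2^-1)%:C)%C.
exists T => [x|].
  rewrite /= !big_ord_recl !big_ord0 !addr0 /T /= !rnorm_sqr !ReD !ImD !Re_real_mul !Im_real_mul.
  by lra.
have hu : u = 2^-1%:C%C *: (u + v) + 2^-1%:C%C *: (u - v).
  by rewrite -scalerDr addrACA subrr addr0 scale_halfD.
have hv : v = 2^-1%:C%C *: (u + v) + (- 2^-1)%:C%C *: (u - v).
  by rewrite rmorphN scaleNr -scalerBr opprB addrC addrA subrK scale_halfD.
by case=> [|[|[|[|//]]]] _ /=; rewrite !big_ord_recl big_ord0 /= /T /= addr0.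
Qed.

Lemma con_contract (s : R[i]) (u : V) : rnorm s <= 1 -> con [:: s *: u] [:: u].
Proof.
move=> s1; exists (fun _ _ => s) => [v|[|//] _] /=; rewrite !big_ord_recl !big_ord0 !addr0//.
by rewrite rnormM exprMn -[leRHS]mul1r ler_wpM2r ?sqr_ge0// expr_le1// rnorm_ge0.
Qed.

Lemma con_srep4 z : con z (srep 4 [seq 2^-1%:C%C *: v | v <- z]).
Proof.
elim: z => [|u z IH]; first exact: con_refl.
have uh : con [:: u] (srep 4 [:: 2^-1%:C%C *: u]).
  have := con_half4 (2^-1%:C%C *: u) (2^-1%:C%C *: u) (2^-1%:C%C *: u) (2^-1%:C%C *: u).
  rewrite -!scalerDl scalerA -!rmorphD -rmorphM /=.
  by rewrite (_ : 2^-1 * _ = 1 :> R) ?scale1r//; field.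
apply: (con_trans (con_cat uh IH)).
apply: con_perm; rewrite perm_sym; exact: (perm_srep_cat 4 [:: _]).
Qed.

End Contractions.

(** * Matrix norms *)

Section MatrixNorm.
Context {R : realType}.
Local Notation sq z := (rnorm (z : R[i]) ^+ 2).

Lemma l2opnorm_ge0 (V W : normedZmodType R[i]) (m n : nat)
  (f : 'cV[V]_m -> 'cV[W]_n) : 0 <= l2opnorm f.
Proof.
rewrite /l2opnorm; set E := [set _ | _ in _].
have E0 : E (l2norm (f 0)).
  exists 0 => //=; rewrite /l2norm big1 ?sqrtr0 ?ler01// => i _.
  by rewrite mxE rnorm0 expr0n.
have [Eub|nEub] := pselect (has_ubound E).
  by apply: le_trans (ub_le_sup Eub E0); exact: sqrtr_ge0.
(* The supremum of a set without upper bound is 0 by convention. *)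
by rewrite sup_out// => -[].
Qed.

Lemma cstar_norm_le (n : nat) (l : 'M[R[i]]_n) (t : R) : 0 <= t ->
  (forall v : 'cV[R[i]]_n, \sum_i sq ((l *m v) i 0) <= t * \sum_i sq (v i 0)) ->
  cstar_norm l <= Num.sqrt t.
Proof.
move=> t0 lt; apply: ge_sup.
  exists (l2norm (l *m 0 : 'cV_n)), 0 => //=.
  rewrite /l2norm big1 ?sqrtr0// => i _.
  by rewrite mxE rnorm0 expr0n.
move=> _ [v /= v1 <-]; rewrite /l2norm; apply: ler_wsqrtr.
apply: (le_trans (lt v)); rewrite -[leRHS]mulr1 ler_wpM2l//.
move: v1; rewrite /l2norm -[leRHS]sqrtr1 ler_sqrt//.
Qed.

Lemma cstar_norm_nat_le (n : nat) (f : nat -> nat -> R[i]) (t : R) : 0 <= t ->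
  (forall u : nat -> R[i], \sum_(i < n) sq (\sum_(j < n) f i j * u j) <=
     t * \sum_(j < n) sq (u j)) ->
  cstar_norm (\matrix_(i < n, j < n) f i j) <= Num.sqrt t.
Proof.
move=> t0 ft; apply: cstar_norm_le => // v.
pose u (j : nat) := if insub j is Some j' then v j' 0 else 0.
have uE (j : 'I_n) : u j = v j 0.
  by rewrite /u insubT//= => jn; congr (v _ _); exact: val_inj.
have := ft u; rewrite [in X in _ <= X](eq_bigr (fun j : 'I_n => sq (v j 0))).
  apply: le_trans; rewrite le_eqVlt; apply/orP; left; apply/eqP.
  apply: eq_bigr => i _; congr (rnorm _ ^+ 2); rewrite mxE.
  by apply: eq_bigr => j _; rewrite mxE uE.
by move=> j _; rewrite uE.
Qed.

(** Duality: with [y] the transpose applied to [u], the sum [Y] of |y_j|^2 pairs [u] with [T]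
    applied to the conjugate of [y], whence 2 Y <= t X + Y. It is needed because a contraction of
    families acts on matrices of columns through its transpose. *)
Lemma l2_transpose (m n : nat) (T : nat -> nat -> R[i]) (t : R) : 0 < t ->
  (forall v : nat -> R[i], \sum_(i < m) sq (\sum_(j < n) T i j * v j) <=
     t * \sum_(j < n) sq (v j)) ->
  forall u : nat -> R[i], \sum_(j < n) sq (\sum_(i < m) T i j * u i) <=
     t * \sum_(i < m) sq (u i).
Proof.
move=> t0 Tt u; pose y (j : nat) := \sum_(i < m) T i j * u i.
pose Ty (i : nat) := \sum_(j < n) T i j * (y j)^*.
set Y := \sum_(j < n) _; set X := \sum_(i < m) _.
have rc (z : R[i]) : rnorm z^* = rnorm z.
  by apply: (@complexI R); rewrite !rnormE norm_conjC.
have YE : Y = \sum_(i < m) complex.Re (u i * Ty i).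
  have -> : Y = complex.Re (\sum_(j < n) y j * (y j)^*).
    rewrite (big_morph _ (@ReD R) (erefl : complex.Re 0 = 0 :> R)).
    apply: eq_bigr => j _; rewrite -normCK -rnormE -rmorphXn /=.
    by [].
  rewrite -(big_morph _ (@ReD R) (erefl : complex.Re 0 = 0 :> R)).
  congr complex.Re; under [LHS]eq_bigr => j _ do rewrite {1}/y mulr_suml.
  rewrite exchange_big /=; apply: eq_bigr => i _; rewrite mulr_sumr.
  by apply: eq_bigr => j _; rewrite mulrA [u i * _]mulrC.
have Re_le (a b : R[i]) : 2 * complex.Re (a * b) <= t * sq a + t^-1 * sq b.
  apply: (@le_trans _ _ (2 * (rnorm a * rnorm b))).
    by rewrite ler_pM2l// -rnormM Re_le_rnorm.
  rewrite -subr_ge0.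
  rewrite (_ : _ - _ = t^-1 * (t * rnorm a - rnorm b) ^+ 2).
    by rewrite mulr_ge0 ?sqr_ge0// invr_ge0 ltW.
  by field; rewrite gt_eqF.
have : 2 * Y <= t * X + t^-1 * \sum_(i < m) sq (Ty i).
  rewrite YE !mulr_sumr -big_split /=; exact: ler_sum.
have := Tt (fun j => (y j)^*).
rewrite (eq_bigr (fun j : 'I_n => sq (y j))); last by move=> j _; rewrite rc.
rewrite -/Y => h1; have : t^-1 * \sum_(i < m) sq (Ty i) <= Y by rewrite ler_pdivrMl.
by lra.
Qed.

Context {X : operatorSpaceType R}.

Lemma mnorm0 (n : nat) : mnorm (0 : 'M[X]_n) = 0.
Proof.
have := mnormZ n 0 (0 : 'M[X]_n); rewrite rnorm0 mul0r => <-; congr mnorm.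
by apply/matrixP => i j; rewrite !mxE scaler0.
Qed.

Lemma mnorm_ge0 (n : nat) (x : 'M[X]_n) : 0 <= mnorm x.
Proof.
have := mnormD n x (map_mx ( *:%R (-1)) x); rewrite mnormZ rnormN rnorm1 mul1r.
rewrite (_ : x + _ = 0) ?mnorm0; first by lra.
by apply/matrixP => i j; rewrite !mxE scaleN1r subrr.
Qed.

Lemma mnorm_bimodule_le (n : nat) (l : 'M[R[i]]_n) (x : 'M[X]_n) (m : 'M[R[i]]_n) (a b : R) :
  cstar_norm l <= a -> cstar_norm m <= b -> 0 <= a -> 0 <= b ->
  mnorm (mx_bimodule l x m) <= a * mnorm x * b.
Proof.
move=> la mb a0 b0; apply: (le_trans (mnorm_bimodule _ _ _ _)).
have c0 (k : 'M[R[i]]_n) : 0 <= cstar_norm k.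
  exact: l2opnorm_ge0.
by rewrite ler_pM ?mulr_ge0 ?mnorm_ge0 ?ler_wpM2r ?mnorm_ge0.
Qed.

Lemma mnorm_pad (f : nat -> nat -> X) (M N : nat) : (M <= N)%N ->
  (forall i j, (M <= i)%N || (M <= j)%N -> f i j = 0) ->
  mnorm (\matrix_(i < N, j < N) f i j) = mnorm (\matrix_(i < M, j < M) f i j).
Proof.
move=> /subnKC <- f0; move: (N - M)%N => r.
rewrite (_ : (\matrix_(i < M + r, j < M + r) f i j) =
  block_mx (\matrix_(i < M, j < M) f i j) 0 0 (0 : 'M[X]_r));
  first by rewrite mnorm_dsum mnorm0 max_l// mnorm_ge0.
apply/matrixP => i j.
case: (split_ordP i) => i' ->; case: (split_ordP j) => j' ->.
- by rewrite block_mxEul !mxE.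
- by rewrite block_mxEur !mxE /= f0// leq_addr orbT.
- by rewrite block_mxEdl !mxE /= f0// leq_addr.
- by rewrite block_mxEdr !mxE /= f0// leq_addr.
Qed.

End MatrixNorm.

(** * Norming forms on columns over the unitization *)

Section ColumnModule.
Context {R : realType} {A : operatorAlgType R}.
Local Notation C := R[i].
Local Notation sq z := (rnorm (z : R[i]) ^+ 2).

(* The pair [(k, l)] stands for [k + l 1]. *)
Definition unitization : Type := (A * C^o)%type.
HB.instance Definition _ := GRing.Lmodule.copy unitization (A * C^o)%type.
Implicit Types (a b : A).

Definition uact (v : unitization) a : unitization := (oamul v.1 a + v.2 *: a, 0).

Lemma uactDl (v w : unitization) a : uact (v + w) a = uact v a + uact w a.
Proof. by rewrite /uact /= linearDl scalerDl addrACA; congr pair; rewrite /= addr0. Qed.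

Lemma uactZl (t : C) (v : unitization) a : uact (t *: v) a = t *: uact v a.
Proof.
by rewrite /uact /= linearZl_LR /= -scalerA -scalerDr; congr pair; rewrite /= scaler0.
Qed.

Lemma uactDr (v : unitization) a b : uact v (a + b) = uact v a + uact v b.
Proof. by rewrite /uact /= linearDr scalerDr addrACA; congr pair; rewrite /= addr0. Qed.

Lemma uactZr (v : unitization) (t : C) a : uact v (t *: a) = t *: uact v a.
Proof.
rewrite /uact /= linearZr_LR /= scalerA mulrC -scalerA -scalerDr.
by congr pair; rewrite /= scaler0.
Qed.

Lemma uact0l a : uact 0 a = 0.
Proof. by rewrite -[X in uact X](scale0r (0 : unitization)) uactZl scale0r. Qed.

Lemma uactA (v : unitization) a b : uact (uact v a) b = uact v (oamul a b).
Proof. by rewrite /uact /= linearDl linearZl_LR /= -oamulA scale0r addr0. Qed.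

Definition ucols (n : nat) : Type := 'I_n -> unitization.
HB.instance Definition _ n := GRing.Lmodule.copy (ucols n) ('I_n -> unitization).

Definition cact n (v : ucols n) a : ucols n := fun s => uact (v s) a.

Lemma cactDl n (v w : ucols n) a : cact (v + w) a = cact v a + cact w a.
Proof. by apply/funext => s; exact: uactDl. Qed.

Lemma cactZl n (t : C) (v : ucols n) a : cact (t *: v) a = t *: cact v a.
Proof. by apply/funext => s; exact: uactZl. Qed.

Lemma cactDr n (v : ucols n) a b : cact v (a + b) = cact v a + cact v b.
Proof. by apply/funext => s; exact: uactDr. Qed.

Lemma cactZr n (v : ucols n) (t : C) a : cact v (t *: a) = t *: cact v a.
Proof. by apply/funext => s; exact: uactZr. Qed.

Lemma cactA n (v : ucols n) a b : cact (cact v a) b = cact v (oamul a b).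
Proof. by apply/funext => s; exact: uactA. Qed.

Definition cunit n (s : 'I_n) : ucols n := fun r => (0, (r == s)%:R).

Definition mxucol n (x : 'M[A]_n) (j : 'I_n) : ucols n := fun s => (x s j, 0).

(** The reason for adjoining a unit: acting on the unit columns, the entries of [x] produce the
    columns of [x]. The lower bound for the representation rests on this. *)
Lemma mxucolE n (x : 'M[A]_n) j : mxucol x j = \sum_s cact (cunit s) (x s j).
Proof.
apply/funext => r; rewrite fct_sumE (bigD1 r) //= big1 => [|s sr].
  rewrite /cact /uact /cunit /= eqxx scale1r linear0l add0r.
  by apply/eqP; rewrite xpair_eqE /= !addr0 !eqxx.
rewrite /cact /uact /cunit /= eq_sym (negPf sr) scale0r linear0l add0r.
by [].
Qed.

Section Domination.
Context {n : nat}.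
Implicit Types (k z y xi : seq (ucols n)).

Definition cmul (c : nat -> nat -> A) k ck :=
  [/\ size ck = size k,
      mnorm (\matrix_(i < size k, j < size k) c i j) <= 2^-1 &
      forall j, (j < size k)%N -> ck`_j = \sum_(i < size k) cact k`_i (c i j)].

Lemma cmul_nil c : cmul c [::] [::].
Proof.
split=> //=; rewrite (_ : \matrix_(_, _) _ = 0) ?mnorm0 ?invr_ge0//.
by apply/matrixP => -[].
Qed.

Lemma cmul_cat c d k ck l dl : cmul c k ck -> cmul d l dl ->
  exists e, cmul e (k ++ l) (ck ++ dl).
Proof.
move=> [sk nc kE] [sl nd lE]; set m := size k; set m' := size l.
pose e i j := if (i < m)%N then (if (j < m)%N then c i j else 0)
  else (if (j < m)%N then 0 else d (i - m)%N (j - m)%N).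
exists e; split; first by rewrite !size_cat sk sl.
  rewrite size_cat (_ : (\matrix_(_, _) _) = block_mx
    (\matrix_(i < m, j < m) c i j) 0 0 (\matrix_(i < m', j < m') d i j)).
    by rewrite mnorm_dsum ge_max nc nd.
  apply/matrixP => i j.
  case: (split_ordP i) => i' ->; case: (split_ordP j) => j' ->.
  - by rewrite block_mxEul !mxE /e /= !ltn_ord.
  - by rewrite block_mxEur !mxE /e /= ltn_ord ltnNge leq_addr.
  - by rewrite block_mxEdl !mxE /e /= ltn_ord ltnNge leq_addr.
  - by rewrite block_mxEdr !mxE /e /= !ltnNge !leq_addr /= !addKn.
move=> j; rewrite size_cat -/m -/m' big_split_ord /= => jm.
rewrite nth_cat sk -/m; case: ltnP => jlt.
  rewrite [X in _ + X]big1 ?addr0; last first.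
    move=> i _; rewrite /e ltnNge leq_addr /= jlt.
    by rewrite -(scale0r (0 : A)) cactZr scale0r.
  by rewrite kE//; apply: eq_bigr => i _; rewrite /e nth_cat ltn_ord jlt.
rewrite [X in X + _]big1 ?add0r; last first.
  move=> i _; rewrite /e ltn_ord ltnNge jlt /=.
  by rewrite -(scale0r (0 : A)) cactZr scale0r.
rewrite lE ?ltn_subLR//; apply: eq_bigr => i _.
rewrite /e ltnNge leq_addr /= ltnNge jlt /= addKn nth_cat -/m.
by rewrite ltnNge leq_addr /= addKn.
Qed.

Lemma cmul_scale c (t : C) k ck : cmul c k ck ->
  cmul c [seq t *: v | v <- k] [seq t *: v | v <- ck].
Proof.
move=> [sk nc kE]; split; rewrite !size_map// => j jk.
rewrite (nth_map 0) ?sk// kE// scaler_sumr; apply: eq_bigr => i _.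
by rewrite (nth_map 0)// cactZl.
Qed.

(* [dominated z y] forces P z <= P y for every Hilbertian semi-norm P
   on which right multiplication by half-contractions is contractive. *)
Definition dominated z y := exists c k ck,
  cmul c k ck /\ con (k ++ z) (ck ++ y).

Lemma dominated_con z y : con z y -> dominated z y.
Proof. by move=> zy; exists (fun _ _ => 0), [::], [::]; split=> //; exact: cmul_nil. Qed.

Lemma dominated_perm z y : perm_eq z y -> dominated z y.
Proof. by move=> zy; apply: dominated_con; exact: con_perm. Qed.

Lemma dominated_refl z : dominated z z.
Proof. exact: dominated_perm. Qed.

Lemma dominated_cmul c z cz : cmul c z cz -> dominated cz z.
Proof. by move=> cz'; exists c, z, cz; split=> //; apply: con_perm; rewrite perm_catC. Qed.

(** The auxiliary families are concatenated, with a block-diagonal multiplier. Its norm is the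
    maximum of the two, so the bound 1/2 persists. *)
Lemma dominated_trans y z xi : dominated z y -> dominated y xi -> dominated z xi.
Proof.
move=> [c [k [ck [ckP zy]]]] [d [l [dl [dlP yx]]]].
have [e eP] := cmul_cat dlP ckP; exists e, (l ++ k), (dl ++ ck); split=> //.
rewrite -!catA; apply: con_trans (con_cat (con_refl l) zy) _.
apply: con_trans (_ : con (ck ++ l ++ y) _); first by apply: con_perm; rewrite perm_catCA.
apply: con_trans (con_cat (con_refl ck) yx) _.
by apply: con_perm; rewrite perm_catCA.
Qed.

Lemma dominated_cat z y xi : dominated z y -> dominated (z ++ xi) (y ++ xi).
Proof.
move=> [c [k [ck [ckP zy]]]]; exists c, k, ck; split=> //.
by rewrite !catA; exact: con_cat zy (con_refl xi).
Qed.

Lemma dominated_cat2 z y z' y' : dominated z y -> dominated z' y' ->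
  dominated (z ++ z') (y ++ y').
Proof.
move=> zy z'y'; apply: dominated_trans (dominated_cat z' zy) _.
apply: (@dominated_trans (z' ++ y)); first by apply: dominated_perm; rewrite perm_catC.
apply: dominated_trans (dominated_cat y z'y') _.
by apply: dominated_perm; rewrite perm_catC.
Qed.

Lemma dominated_catr z y : dominated y (z ++ y).
Proof. by apply: dominated_con; exact: con_catr. Qed.

Lemma dominated_scale (t : C) z y : dominated z y ->
  dominated [seq t *: v | v <- z] [seq t *: v | v <- y].
Proof.
move=> [c [k [ck [ckP zy]]]]; exists c, [seq t *: v | v <- k], [seq t *: v | v <- ck].
by split; [exact: cmul_scale | rewrite -!map_cat; exact: con_scale].
Qed.

Definition scalar_family xi := {in xi, forall v s, (v s).1 = 0}.

(** [t] bounds the squared norm of the scalar matrix whose rows are the members of [xi]. It is kept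
    positive because [l2_transpose] divides by it. *)
Definition row_bound xi (t : R) := 0 < t /\ forall u : 'I_n -> C,
  \sum_(v <- xi) sq (\sum_s (v s).2 * u s) <= t * \sum_s sq (u s).

Definition scalar_bound z : set R :=
  [set t | exists xi, [/\ scalar_family xi, row_bound xi t & dominated z xi]].

Lemma scalar_bound_cat z z' t t' : scalar_bound z t -> scalar_bound z' t' ->
  scalar_bound (z ++ z') (t + t').
Proof.
move=> [xi [xs [t0 xb] zx]] [yi [ys [t0' yb] zy]]; exists (xi ++ yi); split.
- by move=> v; rewrite mem_cat => /orP[/xs|/ys].
- split; first exact: addr_gt0.
  by move=> u; rewrite big_cat mulrDl lerD.
- exact: dominated_cat2.
Qed.

Lemma scalar_bound_dominated z z' t : dominated z z' -> scalar_bound z' t ->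
  scalar_bound z t.
Proof.
by move=> zz' [xi [xs xb zx]]; exists xi; split=> //; exact: dominated_trans zx.
Qed.

Lemma scalar_bound_half z t : scalar_bound z t ->
  scalar_bound [seq 2^-1%:C%C *: v | v <- z] (t / 4).
Proof.
move=> [xi [xs [t0 xb] zx]]; exists [seq 2^-1%:C%C *: v | v <- xi]; split.
- move=> _ /mapP[v vx ->] s /=.
  by rewrite -[LHS]/(2^-1%:C%C *: (v s).1) (xs v vx) scaler0.
- split; first by rewrite divr_gt0.
  move=> u; rewrite big_map.
  rewrite (eq_bigr (fun v : ucols n => 4^-1 * sq (\sum_s (v s).2 * u s))); last first.
    move=> v _; rewrite -[4^-1]/(4^-1).
    have -> : \sum_s ((2^-1%:C%C *: v) s).2 * u s = 2^-1%:C%C * \sum_s (v s).2 * u s.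
      by rewrite mulr_sumr; apply: eq_bigr => s _; rewrite mulrA.
    by rewrite rnormM rnorm_real exprMn real_normK ?num_real//; congr (_ * _); field.
  by rewrite -mulr_sumr; have := xb u; lra.
- exact: dominated_scale.
Qed.

(** Makes the infimum of the bounds meaningful. A column is a finite sum of scalar columns and of
    unit columns multiplied by elements of [A], and each summand is dominated by a scalar column. *)
Lemma scalar_bound_nonempty z : exists t, scalar_bound z t.
Proof.
have cat z1 z2 : (exists t, scalar_bound z1 t) -> (exists t, scalar_bound z2 t) ->
    exists t, scalar_bound (z1 ++ z2) t.
  by move=> [t1 h1] [t2 h2]; exists (t1 + t2); exact: scalar_bound_cat.
have dom z1 z2 : dominated z1 z2 -> (exists t, scalar_bound z2 t) ->
    exists t, scalar_bound z1 t.
  by move=> d [t ht]; exists t; exact: scalar_bound_dominated ht.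
have nil : exists t, scalar_bound [::] t.
  exists 1, [::]; split=> //; last exact: dominated_refl.
  by split=> // u; rewrite big_nil mul1r sumr_ge0// => s _; rewrite sqr_ge0.
have add u v : (exists t, scalar_bound [:: u] t) -> (exists t, scalar_bound [:: v] t) ->
    exists t, scalar_bound [:: u + v] t.
  move=> hu hv; apply: (dom _ [:: u; u; v; v]).
    apply: dominated_con; have := con_half4 u u v v.
    by rewrite -addrA scalerDr !scale_halfD.
  by apply: (cat [:: u; u] [:: v; v]); [exact: (cat [:: u] [:: u])|exact: (cat [:: v] [:: v])].
have zero : exists t, scalar_bound [:: 0] t.
  apply: (dom _ [::]) => //; apply: dominated_con; exists (fun _ _ => 0) => [x|[|//] _] /=.
    by rewrite !big_ord_recl !big_ord0 rnorm0 expr0n addr0.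
  by rewrite big_ord0.
have scal s (l : C) : exists t, scalar_bound [:: l *: cunit s] t.
  exists (sq l + 1), [:: l *: cunit s]; split; last exact: dominated_refl.
    by move=> v; rewrite mem_seq1 => /eqP vE r; rewrite vE -[LHS]/(l *: 0) scaler0.
  split; first by rewrite ltr_wpDl ?sqr_ge0.
  move=> u; rewrite big_seq1.
  have -> : \sum_r ((l *: cunit s) r).2 * u r = l * u s.
    transitivity (\sum_r l * (r == s)%:R * u r) => //.
    rewrite (bigD1 s) //= big1 => [|r rs]; first by rewrite eqxx mulr1 addr0.
    by rewrite (negPf rs) mulr0 mul0r.
  rewrite rnormM exprMn (bigD1 s) //=.
  have h1 := sqr_ge0 (rnorm (u s)); have h2 := sqr_ge0 (rnorm l).
  have h3 : 0 <= \sum_(i | i != s) sq (u i) by rewrite sumr_ge0// => i _; rewrite sqr_ge0.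
  rewrite mulrDr mulrDl mul1r -addrA lerDl addr_ge0//; first by rewrite mulr_ge0// addr_ge0.
have act s a : exists t, scalar_bound [:: cact (cunit s) a] t.
  (* [cunit s] acted on by [a] is [r] times [cunit s] acted on by a / r, which is a
     half-contraction; the [+ 1] keeps [r] positive when [a = 0]. *)
  pose r := 2 * rnorm a + 1; have r0 : 0 < r by rewrite ltr_wpDl// mulr_ge0// rnorm_ge0.
  apply: (dom _ [:: r%:C%C *: cunit s]); last exact: scal.
  apply: (@dominated_cmul (fun _ _ => r^-1%:C%C *: a)); split=> //=.
    rewrite (_ : (\matrix_(_, _) _) = const_mx (r^-1%:C%C *: a)); last first.
      by apply/matrixP => i j; rewrite !mxE.
    rewrite mnorm_M1 rnormZ rnorm_real ger0_norm; last by rewrite invr_ge0 ltW.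
    rewrite ler_pdivrMl// /r; have := rnorm_ge0 a; lra.
  case=> // _; rewrite big_ord_recl big_ord0 addr0 /= cactZl cactZr.
  by rewrite scalerA -rmorphM /= mulfV ?scale1r// gt_eqF.
elim: z => // v z IH; apply: (cat [:: v] z _ IH).
have -> : v = \sum_s (cact (cunit s) (v s).1 + (v s).2 *: cunit s).
  apply/funext => r; rewrite fct_sumE (bigD1 r) //= big1 => [|s sr].
    rewrite addr0 -[(_ + _) r]/(cact (cunit r) (v r).1 r + (v r).2 *: cunit r r).
    rewrite /cact /uact /cunit /= eqxx linear0l add0r scale1r.
    case: (v r) => a l /=; rewrite -[_ + _]/(a + l *: 0, 0 + l * 1) scaler0 addr0.
    by rewrite add0r mulr1.
  rewrite -[(_ + _) r]/(cact (cunit s) (v s).1 r + (v s).2 *: cunit s r).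
  rewrite /cact /uact /cunit /= eq_sym (negPf sr) linear0l add0r scale0r add0r.
  by rewrite -[LHS]/((v s).2 *: 0, (v s).2 * 0) scaler0 mulr0.
by elim/big_ind: _ => // s _; apply: add.
Qed.

End Domination.
End ColumnModule.

(** * The columns of x are dominated only by scalar families of row norm at least |x| *)

Section KeyEstimate.
Context {R : realType} {A : operatorAlgType R} {n : nat}.
Local Notation C := R[i].
Local Notation sq z := (rnorm (z : R[i]) ^+ 2).
Implicit Types (k z y xi : seq (@ucols R A n)).

(** Zero beyond [n], so that columns of length [n] fit into square matrices of any size [N >= n]. *)
Let coord (v : ucols n) (s : nat) : unitization :=
  if insub s is Some s' then v s' else (0 : @unitization R A).

Let coord_out (v : ucols n) s : (n <= s)%N -> coord v s = 0.
Proof. by move=> ns; rewrite /coord insubN// -leqNgt. Qed.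

Let coord_ord (v : ucols n) (s : 'I_n) : coord v s = v s.
Proof. by rewrite /coord insubT//= => sn; congr v; exact: val_inj. Qed.

Let coord0 s : coord 0 s = 0.
Proof. by rewrite /coord; case: insub. Qed.

Let coord_sum (m : nat) (T : nat -> C) (f : nat -> ucols n) s :
  coord (\sum_(j < m) T j *: f j) s = \sum_(j < m) T j *: coord (f j) s.
Proof.
rewrite /coord; case: insubP => [s' _ _|_]; first by rewrite fct_sumE.
by rewrite big1// => j _; rewrite scaler0.
Qed.

Let coord_cact_sum (m : nat) (f : nat -> ucols n) (c : nat -> A) s :
  coord (\sum_(j < m) cact (f j) (c j)) s = \sum_(j < m) uact (coord (f j) s) (c j).
Proof.
rewrite /coord; case: insubP => [s' _ _|_]; first by rewrite fct_sumE.
by rewrite big1// => j _; rewrite uact0l.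
Qed.

Let fst_sum (m : nat) (f : nat -> @unitization R A) :
  (\sum_(j < m) f j).1 = \sum_(j < m) (f j).1.
Proof. by elim: m => [|m IH]; rewrite ?big_ord0// !big_ord_recr /= -IH. Qed.

Let snd_sum (m : nat) (f : nat -> @unitization R A) :
  (\sum_(j < m) f j).2 = \sum_(j < m) (f j).2.
Proof. by elim: m => [|m IH]; rewrite ?big_ord0// !big_ord_recr /= -IH. Qed.

Let fst_mx N a : 'M[A]_N := \matrix_(s < N, i < N) (coord a`_i s).1.

Let cstar_one_le (N : nat) : cstar_norm (1%:M : 'M[C]_N) <= 1.
Proof.
by rewrite -[leRHS]sqrtr1; apply: cstar_norm_le => // v; rewrite mul1mx mul1r.
Qed.

(** With families as the columns of a matrix, [T] acts as right multiplication by its transpose. *)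
Let con_fst_mx (N : nat) a b : (size a <= N)%N -> (size b <= N)%N -> con a b ->
  mnorm (fst_mx N a) <= mnorm (fst_mx N b).
Proof.
move=> aN bN /(con_pad aN bN) [T Tc aE].
have T1 : cstar_norm (\matrix_(j < N, i < N) T i j) <= 1.
  rewrite -[leRHS]sqrtr1; apply: (cstar_norm_nat_le (f := fun j i => T i j)) => //.
  by apply: l2_transpose => // v; rewrite mul1r; exact: Tc.
have -> : fst_mx N a = mx_bimodule 1%:M (fst_mx N b) (\matrix_(j < N, i < N) T i j).
  apply/matrixP => s i; rewrite !mxE aE (coord_sum _ (T i) (fun j => b`_j)) (fst_sum _ (fun j => T i j *: coord b`_j s)) [RHS](bigD1 s) //=.
  rewrite [X in _ + X]big1 ?addr0; last first.
    by move=> p ps; rewrite big1// => j _; rewrite !mxE eq_sym (negPf ps) mul0r scale0r.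
  by apply: eq_bigr => j _; rewrite !mxE eqxx mul1r.
have := mnorm_bimodule_le (fst_mx N b) (cstar_one_le N) T1 ler01 ler01.
by rewrite mul1r mulr1.
Qed.

(** The members of [ck] have no scalar part, so only [xi] contributes to the scalar part of [a]. *)
Let snd_mx_le (N : nat) a ck xi (t : R) : (n <= N)%N ->
  (size a <= N)%N -> (size (ck ++ xi) <= N)%N -> con a (ck ++ xi) ->
  (forall j s, (coord ck`_j s).2 = 0) -> row_bound xi t ->
  cstar_norm (\matrix_(s < N, i < N) (coord a`_i s).2) <= Num.sqrt t.
Proof.
move=> nN aN bN /(con_pad aN bN) [T Tc aE] ck0 [t0 xb].
apply: (cstar_norm_nat_le (f := fun s i => (coord a`_i s).2)); first exact: ltW.
apply: (l2_transpose (T := fun i s => (coord a`_i s).2)) => // v.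
pose g j := \sum_(s < N) (coord (ck ++ xi)`_j s).2 * v s.
apply: (@le_trans _ _ (\sum_(j < N) sq (g j))).
  rewrite (le_trans _ (Tc g))// le_eqVlt; apply/orP; left; apply/eqP.
  apply: eq_bigr => i _; congr (rnorm _ ^+ 2).
  under eq_bigr => s _ do rewrite aE (coord_sum _ (T i) (fun j => (ck ++ xi)`_j)) (snd_sum _ (fun j => T i j *: coord (ck ++ xi)`_j s)) mulr_suml.
  rewrite exchange_big /=; apply: eq_bigr => j _; rewrite /g mulr_sumr.
  by apply: eq_bigr => s _; rewrite mulrA.
have gE u : \sum_(s < N) (coord u s).2 * v s = \sum_(s < n) (u s).2 * v s.
  rewrite (big_ord_pad (g := fun s => (coord u s).2 * v s) nN).
    by apply: eq_bigr => s _; rewrite coord_ord.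
  by move=> s ns; rewrite coord_out// mul0r.
rewrite (big_ord_pad (g := fun j => sq (g j)) bN); last first.
  move=> j jb; rewrite /g big1 ?rnorm0 ?expr0n// => s _.
  by rewrite nth_default// coord0 mul0r.
rewrite size_cat big_split_ord /= big1 ?add0r; last first.
  move=> j _; rewrite /g big1 ?rnorm0 ?expr0n// => s _.
  by rewrite nth_cat ltn_ord ck0 mul0r.
rewrite (eq_bigr (fun j : 'I_(size xi) => sq (\sum_(s < n) (xi`_j s).2 * v s))); last first.
  move=> j _; rewrite /g nth_cat ltnNge leq_addr /= addKn.
  by rewrite gE.
have := xb (fun s => v s); rewrite (big_nth 0) big_mkord => /le_trans; apply.
rewrite ler_wpM2l ?(ltW t0)// (big_ord_widen N (fun j => sq (v j)) nN).
rewrite [leRHS](bigID (fun j : 'I_N => (j < n)%N)) /=.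
by rewrite lerDl sumr_ge0// => j _; rewrite sqr_ge0.
Qed.

(* Write [k ++ z = T (k c ++ xi)]. As xi is scalar, the A-part Z of the left
   side satisfies [Z = T ((Z + L) c)] where L is its scalar part, so that
   [|Z| <= (|Z| + |L|) / 2], i.e. [|Z| <= |L| <= |xi|]. *)
Lemma norm_le_scalar_bound (x : 'M[A]_n) (t : R) :
  scalar_bound [seq mxucol x j | j <- enum 'I_n] t -> mnorm x ^+ 2 <= t.
Proof.
set z := [seq _ | _ <- _].
have zn : size z = n by rewrite size_map size_enum_ord.
move=> [xi [xs [t0 xb] [c [k [ck [[sck nc ckE] [T Tc TE]]]]]]].
set m := size k in nc ckE sck; pose q := size xi.
have kzb : con (k ++ z) (ck ++ xi) by exists T.
(* Room for both families and for the [n] coordinates of a column. *)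
pose N := (m + n + q)%N.
have aN : (size (k ++ z) <= N)%N by rewrite size_cat zn leq_addr.
have bN : (size (ck ++ xi) <= N)%N by rewrite size_cat sck /N addnAC leq_addr.
have mN : (m <= N)%N by rewrite /N -addnA leq_addr.
have nN : (n <= N)%N by rewrite /N addnAC leq_addl.
pose Z := fst_mx N (k ++ z); pose W := fst_mx N (ck ++ xi).
pose L : 'M[C]_N := \matrix_(s, i) (coord (k ++ z)`_i s).2.
pose d i j := if (i < m)%N && (j < m)%N then c i j else 0.
pose D : 'M[A]_N := \matrix_(i, j) d i j.
have L1 : cstar_norm L <= Num.sqrt t.
  apply: (snd_mx_le nN aN bN kzb) => // j s.
  have [jm|jm] := ltnP j m; last by rewrite nth_default ?sck// coord0.
  rewrite ckE// (coord_cact_sum _ (fun i => k`_i) (fun i => c i j)).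
  rewrite (snd_sum _ (fun i => uact (coord k`_i s) (c i j))).
  by rewrite big1.
have D1 : mnorm D <= 2^-1.
  apply: le_trans nc; rewrite (mnorm_pad (f := d) mN).
    rewrite le_eqVlt; apply/orP; left; apply/eqP; congr mnorm.
    by apply/matrixP => i j; rewrite !mxE /d !ltn_ord.
  by move=> i j; rewrite /d !ltnNge => /orP[] -> //=; rewrite andbF.
have ZW : mnorm Z <= mnorm W by exact: con_fst_mx.
have WZ : mnorm W <= 2^-1 * (mnorm Z + Num.sqrt t).
  (* The A-part of [ck] is (Z + L) D, as [D] is [c] padded by zeros outside the block of [k]; the
     members of [xi] are scalar and add nothing. *)
  have -> : W = mx_product oamul Z D + mx_bimodule L D 1%:M.
    apply/matrixP => s i; rewrite !mxE.
    have -> : \sum_p \sum_r (L s p * (1%:M : 'M[C]_N) r i) *: D p r =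
        \sum_(p < N) (coord (k ++ z)`_p s).2 *: d p i.
      apply: eq_bigr => p _; rewrite (bigD1 i) //= big1 ?addr0.
        by rewrite !mxE eqxx mulr1.
      by move=> r ri; rewrite !mxE (negPf ri) mulr0 scale0r.
    rewrite (eq_bigr (fun p : 'I_N => oamul (coord (k ++ z)`_p s).1 (d p i))); last first.
      by move=> p _; rewrite !mxE.
    rewrite -big_split /=; have [im|im] := ltnP i m; last first.
      rewrite nth_cat sck ltnNge im /= big1; last first.
        by move=> p _; rewrite /d [(i < m)%N]ltnNge im andbF linear0r scaler0 addr0.
      rewrite /coord; case: insubP => // s' _ _.
      have [ix|ix] := ltnP (i - m) (size xi); last by rewrite nth_default.
      by rewrite xs// mem_nth.
    rewrite (big_ord_pad (g := fun p => oamul (coord (k ++ z)`_p s).1 (d p i)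
      + (coord (k ++ z)`_p s).2 *: d p i) mN); last first.
      by move=> p mp; rewrite /d ltnNge mp /= linear0r scaler0 addr0.
    rewrite nth_cat sck im ckE// (coord_cact_sum _ (fun p => k`_p) (fun p => c p i)).
    rewrite (fst_sum _ (fun p => uact (coord k`_p s) (c p i))).
    by apply: eq_bigr => p _; rewrite nth_cat -/m ltn_ord /d ltn_ord im.
  apply: (le_trans (mnormD _ _ _)).
  have := mnormM _ Z D; have := mnorm_bimodule_le D L1 (cstar_one_le N) (sqrtr_ge0 _) ler01.
  rewrite mulr1 => h1 h2.
  have h3 : mnorm Z * mnorm D <= mnorm Z * 2^-1 by rewrite ler_wpM2l// mnorm_ge0.
  have h4 : Num.sqrt t * mnorm D <= Num.sqrt t * 2^-1 by rewrite ler_wpM2l// sqrtr_ge0.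
  lra.
have xZ : mnorm x <= mnorm Z.
  pose f s i := (coord z`_i s).1.
  have -> : mnorm x = mnorm (\matrix_(s < N, i < N) f s i).
    rewrite (mnorm_pad (f := f) nN); last first.
      move=> s i /orP[h|h]; first by rewrite /f coord_out.
      by rewrite /f nth_default ?zn// coord0.
    congr mnorm; apply/matrixP => s i; rewrite !mxE /f coord_ord.
    by rewrite (nth_map i) ?size_enum_ord// nth_ord_enum.
  by apply: (con_fst_mx (a := z)); rewrite ?zn//; exact: con_catr.
rewrite -(sqr_sqrtr (ltW t0)) ler_pXn2r ?nnegrE ?mnorm_ge0 ?sqrtr_ge0//.
lra.
Qed.

End KeyEstimate.

Lemma sum_enum_ord (V : nmodType) (m : nat) (f : 'I_m -> V) :
  \sum_(j <- enum 'I_m) f j = \sum_j f j.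
Proof. by rewrite big_enum. Qed.

(** * The gauge of scalar domination and the norming form of a matrix *)

Section Gauge.
Context {R : realType} {A : operatorAlgType R} {n : nat}.
Local Notation sq z := (rnorm (z : R[i]) ^+ 2).
Implicit Types (z y xi : seq (@ucols R A n)).

Definition scalar_gauge z : R := inf (scalar_bound z).

Lemma scalar_bound_gt0 z t : scalar_bound z t -> 0 < t.
Proof. by move=> [xi [_ [t0 _] _]]. Qed.

Lemma scalar_gauge_le z t : scalar_bound z t -> scalar_gauge z <= t.
Proof.
by apply: ge_inf; exists 0 => s /scalar_bound_gt0/ltW.
Qed.

Lemma le_scalar_gauge z (c : R) :
  (forall t, scalar_bound z t -> c <= t) -> c <= scalar_gauge z.
Proof.
by move=> zc; apply: lb_le_inf; [exact: scalar_bound_nonempty|move=> t /zc].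
Qed.

Lemma scalar_gauge_sub z y : scalar_gauge (z ++ y) <= scalar_gauge z + scalar_gauge y.
Proof.
rewrite -lerBlDr; apply: le_scalar_gauge => t zt.
rewrite lerBlDr addrC -lerBlDr; apply: le_scalar_gauge => s ys.
by rewrite lerBlDr addrC; apply: scalar_gauge_le; exact: scalar_bound_cat.
Qed.

Lemma scalar_gauge_mono z y : dominated z y -> scalar_gauge z <= scalar_gauge y.
Proof.
move=> zy; apply: le_scalar_gauge => t yt; apply: scalar_gauge_le.
exact: scalar_bound_dominated yt.
Qed.

Lemma scalar_gauge_srep_le k z : scalar_gauge (srep k z) <= k%:R * scalar_gauge z.
Proof.
elim: k => [|k IH]; last first.
  rewrite srepS -natr1 mulrDl mul1r addrC.
  by apply: (le_trans (scalar_gauge_sub _ _)); rewrite lerD2l.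
(* Bounds are strictly positive: the empty family admits every [e > 0], but not 0. *)
rewrite mul0r; apply/ler_addgt0Pr => e e0; rewrite add0r; apply: scalar_gauge_le.
exists [::]; split=> //; last exact: dominated_refl.
by split=> // u; rewrite big_nil mulr_ge0 ?(ltW e0)// sumr_ge0// => s _; rewrite sqr_ge0.
Qed.

(* [z] is the image of four copies of [z / 2] under a row contraction, so it is
   dominated by half of any scalar family dominating four copies of [z]. *)
Lemma scalar_gauge_srep4 z : 4 * scalar_gauge z <= scalar_gauge (srep 4 z).
Proof.
apply: le_scalar_gauge => t zt.
rewrite -ler_pdivlMl// mulrC; apply: scalar_gauge_le.
apply: (scalar_bound_dominated _ (scalar_bound_half zt)).
apply: dominated_con; have := con_srep4 z.
by rewrite /srep map_flatten map_nseq.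
Qed.

(** The lower bound holds for powers of 4 by iterating the case of four copies. For general [k],
    subadditivity along 4^k = k + (4^k - k) transfers it. *)
Lemma scalar_gauge_srep k z : scalar_gauge (srep k z) = k%:R * scalar_gauge z.
Proof.
apply/eqP; rewrite eq_le scalar_gauge_srep_le /=.
have pow m : 4 ^+ m * scalar_gauge z <= scalar_gauge (srep (4 ^ m) z).
  elim: m => [|m IH]; first by rewrite expr0 mul1r /srep /= cats0.
  rewrite exprS expnS -srep_srep -mulrA.
  by apply: le_trans (scalar_gauge_srep4 _); rewrite ler_pM2l.
have km : (k <= 4 ^ k)%N by rewrite ltnW// ltn_expl.
have := pow k; rewrite -{1}(subnKC km) srepD => /le_trans/(_ (scalar_gauge_sub _ _)).
have := scalar_gauge_srep_le (4 ^ k - k) z.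
by rewrite natrB// natrX; lra.
Qed.

Lemma scalar_gaugeP : sgauge (@dominated R A n) scalar_gauge.
Proof.
split; [exact: scalar_gauge_sub | exact: scalar_gauge_mono | exact: scalar_gauge_srep].
Qed.

Lemma scalar_gauge_unit : scalar_gauge [seq cunit s | s <- enum 'I_n] <= 1.
Proof.
apply: scalar_gauge_le; exists [seq cunit s | s <- enum 'I_n]; split.
- by move=> _ /mapP[s _ ->] r.
- split=> // u; rewrite mul1r big_map enumT le_eqVlt; apply/orP; left; apply/eqP.
  apply: eq_bigr => s _; congr (rnorm _ ^+ 2).
  rewrite (bigD1 s) //= big1 => [|r rs]; first by rewrite eqxx mul1r addr0.
  by rewrite (negPf rs) mul0r.
- exact: dominated_refl.
Qed.

(* [seq_hahn_banach] at the columns of [x], whose gauge is at least [|x|^2]. *)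
Lemma norming_form (x : 'M[A]_n) : exists q : qform (@ucols R A n),
  [/\ forall (m : nat) (c : 'M[A]_m) (v : 'I_m -> ucols n), mnorm c <= 2^-1 ->
        \sum_j q (\sum_i cact (v i) (c i j)) <= \sum_i q (v i),
      \sum_s q (cunit s) <= 1 &
      mnorm x ^+ 2 <= \sum_j q (mxucol x j)].
Proof.
pose z := [seq mxucol x j | j <- enum 'I_n].
have [p [pg padd pU zp]] := seq_hahn_banach (@dominated_perm R A n)
  (fun a b c => @dominated_cat R A n a b c) (@dominated_catr R A n) z scalar_gaugeP.
have pmono := sg_mono pg.
pose q u := p [:: u].
have pcons u y : p (u :: y) = q u + p y by rewrite -cat1s padd.
have pnil : p [::] = 0 by have := padd [::] [::]; rewrite /=; lra.
have pE y : p y = \sum_(u <- y) q u.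
  by elim: y => [|u y IH]; rewrite ?big_nil// big_cons pcons IH.
have p_map m (f : 'I_m -> ucols n) : p [seq f i | i <- enum 'I_m] = \sum_i q (f i).
  by rewrite pE big_map sum_enum_ord.
have q0 u : 0 <= q u.
  by rewrite -pnil; apply: pmono; exact: (dominated_catr [:: u] [::]).
have qpar u v : q (u + v) + q (u - v) = 2 * (q u + q v).
  have h1 := pmono _ _ (dominated_con (con_butterfly u v)).
  have h2 := pmono _ _ (dominated_con (con_butterflyV u v)).
  by move: h1 h2; rewrite !pcons pnil; lra.
have qc a v : rnorm a <= 1 -> q (a *: v) <= q v.
  by move=> a1; apply: pmono; apply: dominated_con; exact: con_contract.
exists (QForm q0 qpar qc); split=> /=.
- move=> m c v c1.
  pose cn i j := if insub i is Some i' then if insub j is Some j' then c i' j' else 0 else 0.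
  have cnE (i j : 'I_m) : cn i j = c i j.
    rewrite /cn !insubT//= => im jm; congr (c _ _); exact: val_inj.
  pose vs := [seq v i | i <- enum 'I_m].
  pose cs := [seq \sum_i cact (v i) (c i j) | j <- enum 'I_m].
  have : dominated cs vs.
    apply: (@dominated_cmul _ _ _ cn); split.
    - by rewrite !size_map.
    - rewrite size_map size_enum_ord; apply: le_trans c1; rewrite le_eqVlt.
      by apply/orP; left; apply/eqP; congr mnorm; apply/matrixP => i j; rewrite !mxE cnE.
    - rewrite size_map size_enum_ord => j jm.
      rewrite (nth_map (Ordinal jm)) ?size_enum_ord//.
      rewrite (_ : nth _ _ _ = Ordinal jm); last by apply: val_inj; rewrite /= nth_enum_ord.
      apply: eq_bigr => i _; rewrite (nth_map i) ?size_enum_ord// nth_ord_enum.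
      by rewrite -(cnE i (Ordinal jm)).
  by move/pmono; rewrite !p_map.
- have := pU [seq cunit s | s <- enum 'I_n].
  by rewrite p_map => /le_trans; apply; exact: scalar_gauge_unit.
- have -> : \sum_j q (mxucol x j) = p z by rewrite p_map.
  apply: le_trans zp; apply: le_scalar_gauge => t; exact: norm_le_scalar_bound.
Qed.

End Gauge.

(** * Direct sums of quadratic forms *)

Section DependentProduct.
Context {K : pzRingType} {I : Type} (F : I -> lmodType K).

(** The fibres vary with the index, since the norming form of an n x n matrix lives on columns of
    length n. *)
Definition dprod : Type := forall i, F i.

HB.instance Definition _ := gen_eqMixin dprod.
HB.instance Definition _ := gen_choiceMixin dprod.

Implicit Types (v w : dprod).
Let ext v w : (forall i, v i = w i) -> v = w := @functional_extensionality_dep _ _ v w.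

Fact dprod_addA : associative (fun v w : dprod => (fun i => v i + w i) : dprod).
Proof. by move=> u v w; apply: ext => i; exact: addrA. Qed.
Fact dprod_addC : commutative (fun v w : dprod => (fun i => v i + w i) : dprod).
Proof. by move=> v w; apply: ext => i; exact: addrC. Qed.
Fact dprod_add0 : left_id ((fun i => 0) : dprod) (fun v w : dprod => (fun i => v i + w i) : dprod).
Proof. by move=> v; apply: ext => i; exact: add0r. Qed.
Fact dprod_addN : left_inverse ((fun i => 0) : dprod) (fun v : dprod => (fun i => - v i) : dprod)
  (fun v w : dprod => (fun i => v i + w i) : dprod).
Proof. by move=> v; apply: ext => i; exact: addNr. Qed.

HB.instance Definition _ := GRing.isZmodule.Build dprod
  dprod_addA dprod_addC dprod_add0 dprod_addN.

Let scale (a : K) (v : dprod) : dprod := fun i => a *: v i.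
Fact dprod_scaleA a b v : scale a (scale b v) = scale (a * b) v.
Proof. by apply: ext => i; exact: scalerA. Qed.
Fact dprod_scale1 : left_id 1 scale.
Proof. by move=> v; apply: ext => i; exact: scale1r. Qed.
Fact dprod_scaleDr : right_distributive scale +%R.
Proof. by move=> a v w; apply: ext => i; exact: scalerDr. Qed.
Fact dprod_scaleDl v : {morph scale^~ v : a b / a + b}.
Proof. by move=> a b; apply: ext => i; exact: scalerDl. Qed.

HB.instance Definition _ := GRing.Zmodule_isLmodule.Build K dprod
  dprod_scaleA dprod_scale1 dprod_scaleDr dprod_scaleDl.

End DependentProduct.

Definition dprod_fun (K : pzRingType) (I : Type) (F : I -> lmodType K)
  (v : dprod F) : forall i, F i := v.
Coercion dprod_fun : dprod >-> Funclass.

Section DirectSum.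
Context {R : realType} {I : choiceType} {F : I -> lmodType R[i]}.
Context (P : forall i, qform (F i)).
Local Notation prodF := (dprod F).

Definition total (v : prodF) : \bar R := (\esum_(i in [set: I]) (P i (v i))%:E)%E.

Definition qsum_pred : {pred prodF} := [pred v | (total v < +oo)%E].

Lemma total_ge0 v : (0 <= total v)%E.
Proof. by apply: esum_ge0 => i _; rewrite lee_fin qf_ge0. Qed.

Let totalD (v w : prodF) : (\esum_(i in [set: I]) (P i (v i) + P i (w i))%:E =
  total v + total w)%E.
Proof.
by rewrite -esumD// => i _; rewrite lee_fin qf_ge0.
Qed.

Lemma total_le (v w : prodF) : (forall i, P i (v i) <= P i (w i)) -> (total v <= total w)%E.
Proof. by move=> vw; apply: le_esum => i _; rewrite lee_fin. Qed.

Lemma total_par (v w : prodF) :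
  (total (v + w)%R + total (v - w)%R = (total v + total w) + (total v + total w))%E.
Proof.
rewrite -!totalD -esumD; last 2 first.
- by move=> i _; rewrite lee_fin addr_ge0 ?qf_ge0.
- by move=> i _; rewrite lee_fin addr_ge0 ?qf_ge0.
apply: eq_esum => i _; rewrite -EFinD; congr (_%:E).
by have := qf_par (P i) (v i) (w i); rewrite -[(v + w) i]/(v i + w i) -[(v - w) i]/(v i - w i); lra.
Qed.

(** For sums, the parallelogram law bounds the mass of [v + w]. For multiples, [a] is [N.+1] times a
    scalar of modulus at most 1, and repeated addition is covered by sums. *)
Fact qsum_submod_closed : submod_closed qsum_pred.
Proof.
have t0 : 0 \in qsum_pred.
  by rewrite inE /total esum1 ?ltry// => i _; rewrite [P i _]qf0.
have tD v w : v \in qsum_pred -> w \in qsum_pred -> v + w \in qsum_pred.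
  rewrite !inE => vt wt; apply: (@le_lt_trans _ _ (total (v + w)%R + total (v - w)%R)%E).
    by rewrite leeDl// total_ge0.
  by rewrite total_par !lte_add_pinfty.
have tc a v : rnorm a <= 1 -> v \in qsum_pred -> a *: v \in qsum_pred.
  move=> a1; rewrite !inE; apply: le_lt_trans; apply: total_le => i.
  exact: qf_contract.
split=> // a v w vt wt; apply: (tD _ _ _ wt).
pose N := Num.bound (rnorm a).
have aN : rnorm a < N.+1%:R.
  by rewrite (lt_le_trans (archi_boundP (rnorm_ge0 a)))// ler_nat.
pose b := (N.+1%:R^-1 : R)%:C%C * a.
have b1 : rnorm b <= 1.
  by rewrite rnormM rnorm_real ger0_norm ?invr_ge0// ler_pdivrMl// mulr1 ltW.
have nt n : n%:R *: (b *: v) \in qsum_pred.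
  elim: n => [|n IH]; first by rewrite scale0r.
  by rewrite -natr1 scalerDl scale1r; apply: tD => //; exact: tc.
have := nt N.+1; rewrite scalerA /b.
by rewrite -[N.+1%:R : R[i]](rmorph_nat (real_complex R)) mulrA -rmorphM /= mulfV// mul1r.
Qed.

HB.instance Definition _ := GRing.isSubmodClosed.Build R[i] prodF
  qsum_pred qsum_submod_closed.

Record qsum := QSum {
  qsum_fun :> dprod F;
  qsum_subproof : qsum_fun \in qsum_pred
}.

HB.instance Definition _ := [isSub for qsum_fun].
HB.instance Definition _ := [Choice of qsum by <:].
HB.instance Definition _ := [SubChoice_isSubLmodule of qsum by <:].

Lemma qsum_ext (v w : qsum) : (forall i, v i = w i) -> v = w.
Proof. by move=> vw; apply/val_inj/functional_extensionality_dep. Qed.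

Definition qsum_norm (v : qsum) : R := fine (total v).

Lemma qsum_normE v : (qsum_norm v)%:E = total v.
Proof.
rewrite /qsum_norm fineK// ge0_fin_numE ?total_ge0//.
by have := qsum_subproof v; rewrite inE.
Qed.

Fact qsum_norm_ge0 v : 0 <= qsum_norm v.
Proof. by rewrite -lee_fin qsum_normE total_ge0. Qed.

Fact qsum_norm_par v w :
  qsum_norm (v + w) + qsum_norm (v - w) = 2 * (qsum_norm v + qsum_norm w).
Proof.
have -> : 2 * (qsum_norm v + qsum_norm w) =
  (qsum_norm v + qsum_norm w) + (qsum_norm v + qsum_norm w) by ring.
by apply: EFin_inj; rewrite !EFinD !qsum_normE; exact: total_par.
Qed.

Fact qsum_norm_contract a v : rnorm a <= 1 -> qsum_norm (a *: v) <= qsum_norm v.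
Proof.
move=> a1; rewrite -lee_fin !qsum_normE; apply: total_le => i.
exact: qf_contract.
Qed.

Definition qsum_form : qform qsum :=
  QForm qsum_norm_ge0 qsum_norm_par qsum_norm_contract.

Lemma qsum_form_sum_le (m n : nat) (v : 'I_m -> qsum) (w : 'I_n -> qsum) :
  (forall i, \sum_j P i (v j i) <= \sum_k P i (w k i)) ->
  \sum_j qsum_form (v j) <= \sum_k qsum_form (w k).
Proof.
move=> vw; rewrite -lee_fin -!sumEFin.
have E k (u : 'I_k -> qsum) : (\sum_j (qsum_form (u j))%:E =
    \esum_(i in [set: I]) (\sum_j P i (u j i))%:E)%E.
  under [RHS]eq_esum do rewrite -sumEFin.
  rewrite esum_sum; last by move=> i j _ _; rewrite lee_fin qf_ge0.
  by apply: eq_bigr => j _; rewrite qsum_normE.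
by rewrite !E; apply: le_esum => i _; rewrite lee_fin.
Qed.

Lemma total_single i (u : F i) : total (@eqtype.dfwith I F (0 : prodF) i u : prodF) = (P i u)%:E.
Proof.
rewrite /total (esumID [set i]); last by move=> j _; rewrite lee_fin qf_ge0.
rewrite setTI esum_set1 ?lee_fin ?qf_ge0// /dprod_fun dfwith_in esum1 ?adde0//.
by move=> j [_ /= ij]; rewrite dfwith_out ?[P j _]qf0//; apply/eqP => ji; apply: ij.
Qed.

Fact qsum_single_subproof i (u : F i) : (@eqtype.dfwith I F (0 : prodF) i u : prodF) \in qsum_pred.
Proof. by rewrite inE total_single ltry. Qed.

Definition qsum_single i (u : F i) : qsum := QSum (qsum_single_subproof u).

Lemma qsum_single_in i (u : F i) : qsum_single u i = u.
Proof. exact: dfwith_in. Qed.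

Lemma qsum_single_out i (u : F i) j : i != j -> qsum_single u j = 0.
Proof. exact: dfwith_out. Qed.

Lemma qsum_form_single i (u : F i) : qsum_form (qsum_single u) = P i u.
Proof. by rewrite /= /qsum_norm total_single. Qed.

End DirectSum.

(** * Operators on the dual Hilbert space and their adjoints *)

Section DualOperators.
Context {R : realType} {V : lmodType R[i]} (q : qform V).
Local Notation N := (dual_form q).

(** [f] is tested at T v / c: multiplying the resulting inequality by [c] leaves q (T v) / c, which
    is at most q v. *)
Lemma dual_form_pre (f : qdual q) (T : V -> V) (c : R) : 0 < c ->
  (forall a v, T (a *: v) = a *: T v) -> (forall v, q (T v) <= c * q v) ->
  forall v, 2 * complex.Re (f (T v)) - q v <= c * N f.
Proof.
move=> c0 TZ Tc v.
have := dual_norm_ub f (c^-1%:C%C *: T v); rewrite qdualZ Re_real_mul qf_realZ.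
rewrite -(ler_pM2l c0) => h; apply: le_trans h.
rewrite mulrBr (_ : c * (2 * _) = 2 * complex.Re (f (T v))); last by field; rewrite gt_eqF.
rewrite lerD2l lerN2 expr2 !mulrA mulfV ?gt_eqF// mul1r.
by rewrite ler_pdivrMl.
Qed.

Fact qdual_comp_subproof (f : qdual q) (T : V -> V) : linear T ->
  (exists2 c, 0 < c & forall v, q (T v) <= c * q v) ->
  (f \o T : V -> R[i]^o) \in @qdual_pred _ _ q.
Proof.
move=> Tl [c c0 Tc]; apply/qdual_predP; split=> [a u v|] /=; first by rewrite Tl qdualP.
have T0 : T 0 = 0 by have := Tl (-1) 0 0; rewrite scaler0 addr0 scaleN1r addNr.
exists (c * N f) => v; rewrite -lerBlDr; apply: dual_form_pre => // a w.
by have := Tl a w 0; rewrite T0 !addr0.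
Qed.

(** The vectors [v i] are chosen independently, so the sum of the suprema is the supremum of the
    sums. *)
Lemma sum_dual_form_le (n : nat) (g : 'I_n -> qdual q) (c : R) :
  (forall v : 'I_n -> V, \sum_i (2 * complex.Re (g i (v i)) - q (v i)) <= c) ->
  \sum_i N (g i) <= c.
Proof.
move=> gc; apply/ler_addgt0Pr => e e0.
pose d : R := e / n.+1%:R; have d0 : 0 < d by rewrite divr_gt0.
have /choice[v vP] : forall i, exists v,
    N (g i) <= 2 * complex.Re (g i v) - q v + d.
  move=> i; have [v] := riesz_dense (g i) d0; rewrite dual_form_riesz => h.
  by exists v; lra.
apply: (@le_trans _ _ (\sum_i (2 * complex.Re (g i (v i)) - q (v i) + d))).
  exact: ler_sum.
rewrite big_split /= lerD// sumr_const card_ord -mulr_natr -mulrA.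
by rewrite ler_piMr// ?(ltW e0)// mulrC ler_pdivrMr// mul1r ler_nat.
Qed.

Definition dual_hilbert : hilbertType R := hilb (dual_rawHilbert q).

Lemma dual_hilbert_sqr (f : dual_hilbert) : rnorm f ^+ 2 = N f.
Proof. exact: (rnorm_hilb_sqr (X := dual_rawHilbert q)). Qed.

Lemma rieszP a u v : riesz q (a *: u + v) = a^* *: riesz q u + riesz q v.
Proof.
apply: qdual_ext => w; rewrite qdualDE qdualZE !rieszE -!(cformC _ _ w).
by rewrite cformDl cformZl rmorphD rmorphM.
Qed.

(* The adjoint is [f |-> (w |-> <f, S (riesz w)>)]; the reproducing property
   gives the adjunction on the range of [riesz], which is dense. *)
Lemma adjoint_exists (S : bop dual_hilbert) : exists S', is_adjoint S S'.
Proof.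
have [M0 M00 SM0] := bop_bounded S.
pose M := M0 + 1; have Mp : 0 < M by rewrite ltr_wpDl.
have SN (f : dual_hilbert) : N (S f) <= M ^+ 2 * N f.
  rewrite -!dual_hilbert_sqr -exprMn ler_pXn2r ?nnegrE ?rnorm_ge0//.
    apply: (le_trans (SM0 f)); rewrite ler_wpM2r ?rnorm_ge0// lerDl//.
  by rewrite mulr_ge0 ?rnorm_ge0// ltW.
have bound (f : dual_hilbert) w :
    2 * complex.Re (cform N f (S (riesz q w))) - q w <= M ^+ 2 * N f.
  (* Weighted by [M], the pairing of [f] with S (riesz w) is that of M f with S (riesz w) / M, and
     the latter has squared norm at most q w. *)
  have := rform_le N (M%:C%C *: (f : qdual q)) (M^-1%:C%C *: (S (riesz q w) : qdual q)).
  rewrite rformZl rformZr (mulVKf (lt0r_neq0 Mp)) !qf_realZ.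
  have := SN (riesz q w); rewrite dual_form_rieszE Re_cform => h1 h2.
  have : M^-1 ^+ 2 * N (S (riesz q w)) <= q w.
    rewrite exprVn ler_pdivrMl ?exprn_gt0//.
  by lra.
have memb (f : dual_hilbert) :
    (fun w => cform N f (S (riesz q w)) : R[i]^o) \in @qdual_pred _ _ q.
  apply/qdual_predP; split; last by exists (M ^+ 2 * N f) => w; rewrite -lerBlDr.
  move=> a u v; rewrite rieszP.
  have -> : S (a^* *: riesz q u + riesz q v) = a^* *: S (riesz q u) + S (riesz q v).
    exact: bop_linear.
  rewrite -!(cformC _ _ f) cformDl cformZl rmorphD rmorphM.
  by congr (_ * _ + _); exact: conjCK.
pose S' (f : dual_hilbert) : dual_hilbert := QDual (memb f).
have S'b : S' \in @bounded_op R dual_hilbert.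
  apply/bounded_opP; split.
    by move=> a f g; apply: qdual_ext => w; rewrite [LHS]cformDl [X in X + _]cformZl.
  exists M => [|f]; first exact: ltW.
  rewrite -(@ler_pXn2r _ 2)// ?nnegrE ?mulr_ge0 ?rnorm_ge0 ?(ltW Mp)//.
  rewrite exprMn !dual_hilbert_sqr; apply: dual_norm_le => w; exact: bound.
have [T TE] : exists T : bop dual_hilbert,
    forall (f : dual_hilbert) w, (T f : qdual q) w = cform N f (S (riesz q w)).
  by exists (BOp S'b).
exists T => f' f; clear S' S'b memb bound.
have SB (g h : dual_hilbert) : S (g - h) = S g - S h.
  by rewrite -scaleN1r addrC bop_linear scaleN1r addrC.
have jw w : rform N (S (riesz q w)) f = rform N (riesz q w) (T f).
  rewrite (rformC _ (riesz q w)) -(Re_cform _ (T f)) riesz_reproducing TE.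
  by rewrite rformC -Re_cform.
(* For [h = g - riesz w], the difference of the two sides has square at most 2 (M^2 N f + N (T f)) N
   h, hence at most K N h <= e; the [+ 1] makes [K] positive. *)
pose K := 2 * (M ^+ 2 * N f + N (T f)) + 1.
have Tf0 : 0 <= N (T f) by exact: qf_ge0.
have f0 : 0 <= M ^+ 2 * N f by apply: mulr_ge0 (sqr_ge0 _) _; exact: qf_ge0.
have K0 : 0 < K by rewrite /K; lra.
have dense (g : dual_hilbert) : rform N (S g) f = rform N g (T f).
  apply/eqP; rewrite -subr_eq0 -sqrf_eq0 eq_le sqr_ge0 andbT.
  apply/ler_addgt0Pr => e e0; rewrite add0r.
  have [w gw] := riesz_dense g (divr_gt0 e0 K0).
  have [h [Nh Shf hf]] : exists h : dual_hilbert, [/\ N h < e / K,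
      rform N (S h) f = rform N (S g) f - rform N (S (riesz q w)) f &
      rform N h (T f) = rform N g (T f) - rform N (riesz q w) (T f)].
    exists (g - (riesz q w : dual_hilbert)); split; first exact: gw.
      by rewrite SB -rformNl; exact: rformDl.
    by rewrite -rformNl; exact: rformDl.
  move: Shf hf (rform_CS N (S h) f) (rform_CS N h (T f)).
  have : N (S h) * N f <= M ^+ 2 * N h * N f.
    by apply: ler_wpM2r; [exact: qf_ge0 | exact: SN].
  have : N h * K <= e by rewrite -ler_pdivlMr// ltW.
  rewrite /K -(jw w); move: (qf_ge0 N h) (rform N (S (riesz q w)) f).
  move: (rform N (S g) f) (rform N g (T f)) (rform N (S h) f) (rform N h (T f)).
  move: (N (S h)) (N (T f)) (N f) (N h) => a b c d x y xh yh d0 z h1 h2 xE yE h3 h4.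
  have := sqr_ge0 (xh + yh); rewrite (_ : x - y = xh - yh); last by rewrite xE yE; ring.
  lra.
rewrite !hdot_hilb; apply: complex_eqRe; first by rewrite !Re_cform; exact: dense.
rewrite -!cformZl !Re_cform -dense.
have SZ (a : R[i]) (g : dual_hilbert) : S (a *: g) = a *: S g.
  have S0 : S 0 = 0 by have := SB 0 0; rewrite !subrr.
  by have := bop_linear S a g 0; rewrite S0 !addr0.
exact: (congr1 (fun g : qdual q => rform N g f) (esym (SZ _ f'))).
Qed.

End DualOperators.

(** * The representation and its adjoint *)

Section Representation.
Context {R : realType} (A : operatorAlgType R).
Local Notation C := R[i].

Definition mx_index : choiceType := {n : nat & 'M[A]_n}.

Definition index_form (i : mx_index) : qform (@ucols R A (tag i)) :=
  sval (cid (norming_form (tagged i))).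

Definition rep_space : lmodType C := qsum index_form.
Local Notation V := rep_space.
Local Notation Q := (qsum_form index_form).

Lemma index_form_contr (i : mx_index) (m : nat) (c : 'M[A]_m) (v : 'I_m -> ucols (tag i)) :
  mnorm c <= 2^-1 ->
  \sum_j index_form i (\sum_k cact (v k) (c k j)) <= \sum_k index_form i (v k).
Proof. by rewrite /index_form; case: cid => q [/= h _ _]; exact: h. Qed.

Lemma index_form_unit (i : mx_index) : \sum_s index_form i (cunit s) <= 1.
Proof. by rewrite /index_form; case: cid => q []. Qed.

Lemma index_form_col (i : mx_index) :
  mnorm (tagged i) ^+ 2 <= \sum_j index_form i (mxucol (tagged i) j).
Proof. by rewrite /index_form; case: cid => q []. Qed.

(** Dividing [a] by this gives norm at most 1/2; the [+ 1] keeps the divisor positive at [a = 0]. *)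
Definition act_bound (a : A) : R := 2 * rnorm a + 1.

Lemma act_bound_gt0 a : 0 < act_bound a.
Proof. by rewrite ltr_wpDl// mulr_ge0// rnorm_ge0. Qed.

Lemma index_form_cact (i : mx_index) (v : ucols (tag i)) a :
  index_form i (cact v a) <= index_form i ((act_bound a)%:C%C *: v).
Proof.
have r0 := act_bound_gt0 a; set r := act_bound a in r0 *.
have := @index_form_contr i 1 (const_mx (r^-1%:C%C *: a)) (fun _ => r%:C%C *: v).
rewrite mnorm_M1 rnormZ rnorm_real ger0_norm ?invr_ge0 ?(ltW r0)//.
rewrite !big_ord_recl !big_ord0 !addr0 mxE cactZl cactZr.
rewrite scalerA -rmorphM /= mulfV ?gt_eqF// scale1r; apply.
by rewrite ler_pdivrMl// /r /act_bound; have := rnorm_ge0 a; lra.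
Qed.

Fact tact_subproof (v : V) a :
  ((fun i => cact (v i) a) : dprod _) \in qsum_pred index_form.
Proof.
have := qsum_subproof ((act_bound a)%:C%C *: v); rewrite !inE.
by apply: le_lt_trans; apply: total_le => i; exact: index_form_cact.
Qed.

Definition tact (v : V) a : V := QSum (tact_subproof v a).

Lemma tactE (v : V) a i : tact v a i = cact (v i) a. Proof. by []. Qed.

Lemma tact_linear a : linear (tact^~ a).
Proof.
by move=> t v w; apply: qsum_ext => i; rewrite tactE [LHS]cactDl cactZl.
Qed.

Lemma tactP (v : V) t a b : tact v (t *: a + b) = t *: tact v a + tact v b.
Proof. by apply: qsum_ext => i; rewrite tactE cactDr cactZr. Qed.

Lemma tactA (v : V) a b : tact (tact v a) b = tact v (oamul a b).
Proof. by apply: qsum_ext => i; rewrite !tactE cactA. Qed.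

Lemma qsum_sumE (J : Type) (r : seq J) (E : J -> V) i :
  (\sum_(j <- r) E j) i = \sum_(j <- r) E j i.
Proof. exact: (big_morph (fun v : V => v i) (fun _ _ => erefl) erefl). Qed.

Lemma tact_contr (m : nat) (c : 'M[A]_m) (v : 'I_m -> V) : mnorm c <= 2^-1 ->
  \sum_j Q (\sum_k tact (v k) (c k j)) <= \sum_k Q (v k).
Proof.
move=> c1; apply: qsum_form_sum_le => i.
under eq_bigr do rewrite qsum_sumE.
exact: index_form_contr.
Qed.

Lemma tact_bounded a : exists2 c, 0 < c & forall v, Q (tact v a) <= c * Q v.
Proof.
have r0 := act_bound_gt0 a; exists (act_bound a ^+ 2); first exact: exprn_gt0.
move=> v; rewrite -qf_realZ -lee_fin !qsum_normE.
by apply: total_le => i; exact: index_form_cact.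
Qed.

Definition rep_hilbert : hilbertType R := dual_hilbert Q.
Local Notation H := rep_hilbert.
Local Notation N := (dual_form Q).

Lemma rep_hilbert_sqr (f : H) : rnorm f ^+ 2 = N f.
Proof. exact: dual_hilbert_sqr. Qed.

Definition trep_fun a (f : H) : H :=
  QDual (qdual_comp_subproof f (tact_linear a) (tact_bounded a)).

Fact trep_subproof a : trep_fun a \in @bounded_op R H.
Proof.
apply/bounded_opP; split; first by move=> t f g; exact: qdual_ext.
have [c c0 ac] := tact_bounded a.
exists (Num.sqrt c) => [|f]; first exact: sqrtr_ge0.
rewrite -(@ler_pXn2r _ 2)// ?nnegrE ?mulr_ge0 ?rnorm_ge0 ?sqrtr_ge0//.
rewrite exprMn !rep_hilbert_sqr sqr_sqrtr ?(ltW c0)//.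
have T0 : tact 0 a = 0.
  by have := tact_linear a (-1) 0 0; rewrite scaler0 addr0 scaleN1r addNr.
apply: dual_norm_le => v.
apply: (@dual_form_pre _ _ Q f (tact^~ a) c c0 _ ac v) => t w.
by have := tact_linear a t w 0; rewrite T0 !addr0.
Qed.

Definition trep a : bop H := BOp (trep_subproof a).

Lemma trepE a (f : H) v : (trep a f : qdual Q) v = (f : qdual Q) (tact v a).
Proof. by []. Qed.

Lemma trep_linear t a b : trep (t *: a + b) = t *: trep a + trep b.
Proof.
apply: bop_ext => f; apply: qdual_ext => v.
by rewrite trepE tactP qdualP.
Qed.

Lemma trepM a b : trep (oamul a b) = bop_comp (trep a) (trep b).
Proof.
by apply: bop_ext => f; apply: qdual_ext => v; rewrite trepE -tactA.
Qed.

Lemma trep_sumE (m : nat) (c : 'I_m -> A) (f : 'I_m -> H) v :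
  (\sum_j trep (c j) (f j) : qdual Q) v = \sum_j (f j : qdual Q) (tact v (c j)).
Proof.
exact: (big_morph (fun g : qdual Q => g v) (fun _ _ => erefl) erefl).
Qed.

(** Dual to [tact_contr]: evaluating the rows at the vectors [v i] regroups into evaluating [f j] at
    the j-th entry of the row [v] times [c]. *)
Lemma trep_contr (m : nat) (c : 'M[A]_m) (f : 'I_m -> H) : mnorm c <= 2^-1 ->
  \sum_i N (\sum_j trep (c i j) (f j)) <= \sum_j N (f j).
Proof.
move=> c1; apply: sum_dual_form_le => v.
pose w j := \sum_i tact (v i) (c i j).
have E : \sum_i 2 * complex.Re ((\sum_j trep (c i j) (f j) : qdual Q) (v i)) =
    \sum_j 2 * complex.Re ((f j : qdual Q) (w j)).
  rewrite -!mulr_sumr; congr (_ * _).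
  rewrite -!(big_morph _ (@ReD R) (erefl : complex.Re 0 = 0 :> R)).
  congr complex.Re; under eq_bigr do rewrite trep_sumE.
  by rewrite exchange_big /=; apply: eq_bigr => j _; rewrite /w qdual_sum.
rewrite sumrB E; apply: (@le_trans _ _ (\sum_j (2 * complex.Re ((f j : qdual Q) (w j)) - Q (w j)))).
  by rewrite sumrB lerD2l lerN2; exact: tact_contr.
by apply: ler_sum => j _; exact: dual_norm_ub.
Qed.

(* The witnesses are the functionals [<., z_j>], where the [z_j] are the columns
   of [x] in the summand of [rep_space] indexed by [x]. *)
Lemma trep_lower (n : nat) (x : 'M[A]_n) : exists f : 'I_n -> H,
  mnorm x ^+ 2 <= \sum_j N (f j) /\
  (\sum_j N (f j)) ^+ 2 <= \sum_i N (\sum_j trep (x i j) (f j)).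
Proof.
pose i0 : mx_index := Tagged (fun n => 'M[A]_n) x.
pose w (s : 'I_n) : V := qsum_single index_form (i := i0) (cunit s).
pose z (j : 'I_n) : V := qsum_single index_form (i := i0) (mxucol x j).
have zE j : z j = \sum_s tact (w s) (x s j).
  apply: qsum_ext => i; rewrite qsum_sumE.
  have [<-|ii0] := eqVneq i0 i; last first.
    rewrite /z qsum_single_out// big1// => s _; rewrite tactE /w qsum_single_out//.
    by apply/funext => r; exact: uact0l.
  rewrite /z qsum_single_in mxucolE; apply: eq_bigr => s _.
  by rewrite tactE /w qsum_single_in.
pose f j : H := riesz Q (z j).
have fN j : N (f j) = Q (z j) by exact: dual_form_rieszE.
pose S := \sum_j N (f j).
have wS : \sum_s Q (w s) <= 1.
  rewrite (eq_bigr (fun s => index_form i0 (cunit s))); first exact: index_form_unit.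
  by move=> s _; exact: qsum_form_single.
exists f; rewrite -/S; split.
  rewrite /S (eq_bigr (fun j => index_form i0 (mxucol x j))); first exact: (index_form_col i0).
  by move=> j _; rewrite fN; exact: qsum_form_single.
(* The multiplier [S] is optimal: the linear part contributes 2 S^2, and the quadratic part at most
   S^2 because the unit columns have total mass at most 1. *)
have tw i : 2 * complex.Re ((\sum_j trep (x i j) (f j) : qdual Q) (S%:C%C *: w i))
    - Q (S%:C%C *: w i) <= N (\sum_j trep (x i j) (f j)).
  exact: dual_norm_ub.
apply: le_trans (ler_sum _ (fun i _ => tw i)).
rewrite sumrB.
have -> : \sum_i Q (S%:C%C *: w i) = S ^+ 2 * \sum_i Q (w i).
  by rewrite mulr_sumr; apply: eq_bigr => i _; rewrite qf_realZ.
have -> : \sum_i 2 * complex.Re ((\sum_j trep (x i j) (f j) : qdual Q) (S%:C%C *: w i)) = 2 * (S * S).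
  rewrite -mulr_sumr; congr (_ * _).
  under eq_bigr do rewrite qdualZ Re_real_mul trep_sumE.
  rewrite -mulr_sumr; congr (_ * _).
  rewrite -!(big_morph _ (@ReD R) (erefl : complex.Re 0 = 0 :> R)) exchange_big /=.
  rewrite (big_morph _ (@ReD R) (erefl : complex.Re 0 = 0 :> R)).
  apply: eq_bigr => j _; transitivity (complex.Re ((f j : qdual Q) (z j))).
    by rewrite [in RHS]zE qdual_sum.
  rewrite fN.
  by rewrite [f j _]rieszE Re_cform rformvv.
have S0 : 0 <= S by apply: sumr_ge0 => j _; exact: qf_ge0.
have := ler_wpM2l (sqr_ge0 S) wS; lra.
Qed.

End Representation.

(** * Adjoints and norms of matrices of operators *)

Section HilbertFacts.
Context {R : realType} {H : hilbertType R}.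
Implicit Types x y : H.

Lemma Re_hdotxx x : complex.Re (hdot x x) = rnorm x ^+ 2.
Proof. by rewrite hdotE -rnormE -rmorphXn. Qed.

Lemma hdotC x y : hdot y x = (hdot x y)^*.
Proof. by rewrite (hermitian_subproof y x) expr0 mul1r. Qed.

Lemma Re_hdotC x y : complex.Re (hdot y x) = complex.Re (hdot x y).
Proof. by rewrite hdotC; case: (hdot x y). Qed.

Lemma Re_hdot_le x y : 2 * complex.Re (hdot x y) <= rnorm x ^+ 2 + rnorm y ^+ 2.
Proof.
have := sqr_ge0 (rnorm (x - y)); rewrite -!Re_hdotxx.
by rewrite linearBl /= !linearBr /= !(ReD, ReN) (Re_hdotC x y); lra.
Qed.

Lemma adjoint_sym (S T : bop H) : is_adjoint S T -> is_adjoint T S.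
Proof. by move=> ST x y; rewrite hdotC -ST -hdotC. Qed.

Lemma bopD (S : bop H) x y : S (x + y) = S x + S y.
Proof. by have := bop_linear S 1 x y; rewrite !scale1r. Qed.

Lemma bop0 (S : bop H) : S 0 = 0.
Proof. by apply: (addrI (S 0)); rewrite -bopD !addr0. Qed.

Lemma bopZ (S : bop H) a x : S (a *: x) = a *: S x.
Proof. by have := bop_linear S a x 0; rewrite bop0 !addr0. Qed.

(** Duality again: with y = T h and z the image of y under the adjoint matrix, |y|^2 = Re <z, h> and
    2 |y|^2 <= |z|^2 + |h|^2 <= |y|^2 + |h|^2. *)
Lemma adjoint_mx_contr (m : nat) (S T : 'I_m -> 'I_m -> bop H) :
  (forall i j, is_adjoint (S i j) (T i j)) ->
  (forall y : 'I_m -> H, \sum_j rnorm (\sum_i S i j (y i)) ^+ 2 <= \sum_i rnorm (y i) ^+ 2) ->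
  forall h : 'I_m -> H, \sum_i rnorm (\sum_j T i j (h j)) ^+ 2 <= \sum_j rnorm (h j) ^+ 2.
Proof.
move=> ST Sc h; pose y i := \sum_j T i j (h j); pose z j := \sum_i S i j (y i).
have E : \sum_i rnorm (y i) ^+ 2 = \sum_j complex.Re (hdot (z j) (h j)).
  rewrite -(big_morph _ (@ReD R) (erefl : complex.Re 0 = 0 :> R)).
  rewrite (eq_bigr (fun i => complex.Re (hdot (y i) (y i)))); last first.
    by move=> i _; rewrite Re_hdotxx.
  rewrite -(big_morph _ (@ReD R) (erefl : complex.Re 0 = 0 :> R)); congr complex.Re.
  rewrite (eq_bigr (fun i => \sum_j hdot (S i j (y i)) (h j))); last first.
    by move=> i _; rewrite {2}/y linear_sumr /=; apply: eq_bigr => j _; rewrite ST.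
  by rewrite exchange_big /=; apply: eq_bigr => j _; rewrite /z linear_sumlz.
have : 2 * \sum_i rnorm (y i) ^+ 2 <= \sum_j rnorm (z j) ^+ 2 + \sum_j rnorm (h j) ^+ 2.
  by rewrite E mulr_sumr -big_split /=; apply: ler_sum => j _; exact: Re_hdot_le.
by have := Sc y; rewrite -/(z _); lra.
Qed.

Lemma l2norm_sqr (n : nat) (v : 'cV[H]_n) : l2norm v ^+ 2 = \sum_i rnorm (v i 0) ^+ 2.
Proof. by rewrite sqr_sqrtr// sumr_ge0// => i _; rewrite sqr_ge0. Qed.

Lemma l2norm_ge0 (n : nat) (v : 'cV[H]_n) : 0 <= l2norm v.
Proof. exact: sqrtr_ge0. Qed.

Section MatrixOfOperators.
Context {n : nat} (T : 'M[bop H]_n) (c : R).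
Hypothesis c0 : 0 <= c.
Hypothesis Tc : forall v : 'I_n -> H,
  \sum_i rnorm (\sum_j T i j (v j)) ^+ 2 <= c ^+ 2 * \sum_j rnorm (v j) ^+ 2.

Let T_le v : l2norm (bop_mx_fun T v) <= c * l2norm v.
Proof.
rewrite -(@ler_pXn2r _ 2)// ?nnegrE ?mulr_ge0 ?l2norm_ge0//.
rewrite exprMn !l2norm_sqr; apply: le_trans (Tc (fun j => v j 0)).
by apply: ler_sum => i _; rewrite mxE.
Qed.

Let T_le1 v : l2norm v <= 1 -> l2norm (bop_mx_fun T v) <= c.
Proof. by move=> v1; apply: (le_trans (T_le v)); rewrite ler_piMr. Qed.

Lemma bop_mnorm_le : mnorm T <= c.
Proof.
apply: ge_sup; last by move=> _ [v /= v1 <-]; exact: T_le1.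
exists (l2norm (bop_mx_fun T 0)), 0 => //=; rewrite /l2norm big1 ?sqrtr0// => i _.
by rewrite mxE rnorm0 expr0n.
Qed.

(** The a priori bound [c] ensures that the norm is a true supremum and not the default value at an
    unbounded set. *)
Lemma bop_mnorm_ge (v : 'I_n -> H) :
  \sum_i rnorm (\sum_j T i j (v j)) ^+ 2 <= mnorm T ^+ 2 * \sum_j rnorm (v j) ^+ 2.
Proof.
set s := \sum_j rnorm (v j) ^+ 2; have s0 : 0 <= s by apply: sumr_ge0 => j _; exact: sqr_ge0.
have [s_eq0|sn0] := eqVneq s 0.
  by have := Tc v; rewrite -/s s_eq0 !mulr0.
have sp : 0 < s by rewrite lt_def sn0.
pose t := Num.sqrt s; have tp : 0 < t by rewrite sqrtr_gt0.
have ts : t ^+ 2 = s by rewrite sqr_sqrtr.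
pose u : 'cV[H]_n := \col_j (t^-1%:C%C *: v j).
have rt (x : H) : rnorm (t^-1%:C%C *: x) ^+ 2 = s^-1 * rnorm x ^+ 2.
  by rewrite rnormZ exprMn rnorm_real real_normK ?num_real// exprVn ts.
have u1 : l2norm u <= 1.
  rewrite -(@ler_pXn2r _ 2)// ?nnegrE ?l2norm_ge0// expr1n l2norm_sqr.
  rewrite (eq_bigr (fun j => s^-1 * rnorm (v j) ^+ 2)); last by move=> j _; rewrite mxE rt.
  by rewrite -mulr_sumr mulVf.
have Tu : l2norm (bop_mx_fun T u) ^+ 2 = s^-1 * \sum_i rnorm (\sum_j T i j (v j)) ^+ 2.
  rewrite l2norm_sqr mulr_sumr; apply: eq_bigr => i _; rewrite mxE -rt scaler_sumr.
  by congr (rnorm _ ^+ 2); apply: eq_bigr => j _; rewrite mxE bopZ.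
rewrite mulrC -ler_pdivrMl// -Tu ler_pXn2r ?nnegrE ?l2norm_ge0 ?l2opnorm_ge0//.
apply: ub_le_sup; last by exists u.
by exists c => _ [w /= w1 <-]; exact: T_le1.
Qed.

End MatrixOfOperators.
End HilbertFacts.

(** * The Hilbert sum of two copies and its flip *)

Section HilbertProduct.
Context {R : realType} (X : rawHilbert R).

Definition pair_norm (v : X * X) : R := rh_form X v.1 + rh_form X v.2.

Fact pair_norm_ge0 v : 0 <= pair_norm v.
Proof. by rewrite addr_ge0 ?qf_ge0. Qed.

Fact pair_norm_par (u v : X * X) :
  pair_norm (u + v) + pair_norm (u - v) = 2 * (pair_norm u + pair_norm v).
Proof.
rewrite /pair_norm /=; have := qf_par (rh_form X) u.1 v.1.
have := qf_par (rh_form X) u.2 v.2; lra.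
Qed.

Fact pair_norm_contract a (v : X * X) : rnorm a <= 1 -> pair_norm (a *: v) <= pair_norm v.
Proof. by move=> a1; rewrite lerD// qf_contract. Qed.

Definition pair_form : qform (X * X)%type :=
  QForm pair_norm_ge0 pair_norm_par pair_norm_contract.

Fact pair_definite (v : X * X) : pair_form v = 0 -> v = 0.
Proof.
move=> /eqP; rewrite paddr_eq0 ?qf_ge0// => /andP[/eqP v1 /eqP v2].
by case: v v1 v2 => x y /= /rh_definite -> /rh_definite ->.
Qed.

Fact pair_complete (u : nat -> X * X) : q_cauchy pair_form u ->
  exists l, q_converges pair_form u l.
Proof.
move=> uc.
have [|l1 l1P] := @rh_complete _ X (fun n => (u n).1).
  move=> e /uc[n0 n0P]; exists n0 => m n m0 n0n; apply: le_lt_trans (n0P m n m0 n0n).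
  by rewrite lerDl qf_ge0.
have [|l2 l2P] := @rh_complete _ X (fun n => (u n).2).
  move=> e /uc[n0 n0P]; exists n0 => m n m0 n0n; apply: le_lt_trans (n0P m n m0 n0n).
  by rewrite lerDr qf_ge0.
exists (l1, l2) => e e0; have e2 : 0 < e / 2 by rewrite divr_gt0.
have [n1 h1] := l1P _ e2; have [n2 h2] := l2P _ e2.
exists (maxn n1 n2) => n; rewrite geq_max => /andP[/h1 a1 /h2 a2].
by rewrite (splitr e); exact: ltrD.
Qed.

Definition pair_rawHilbert : rawHilbert R := RawHilbert pair_definite pair_complete.

Local Notation H := (hilb X).
Local Notation HH := (hilb pair_rawHilbert).

Lemma rnorm_pair (v : HH) : rnorm v ^+ 2 = rnorm (v.1 : H) ^+ 2 + rnorm (v.2 : H) ^+ 2.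
Proof. by rewrite !rnorm_hilb_sqr. Qed.

Lemma hdot_pair (u v : HH) : hdot u v = hdot (u.1 : H) v.1 + hdot (u.2 : H) v.2.
Proof.
have rE (x y : X * X) : rform pair_form x y =
    rform (rh_form X) x.1 y.1 + rform (rh_form X) x.2 y.2.
  by rewrite /rform /= /pair_norm /=; field.
rewrite !hdot_hilb; apply/eqP; rewrite eq_complex /= !rE.
by rewrite !eqxx.
Qed.

Lemma sum_fst (m : nat) (v : 'I_m -> HH) : (\sum_j v j).1 = \sum_j ((v j).1 : H).
Proof. exact: (big_morph (fun v : HH => v.1 : H) (fun _ _ => erefl) erefl). Qed.

Lemma sum_snd (m : nat) (v : 'I_m -> HH) : (\sum_j v j).2 = \sum_j ((v j).2 : H).
Proof. exact: (big_morph (fun v : HH => v.2 : H) (fun _ _ => erefl) erefl). Qed.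

Fact pair_bop_subproof (S T : bop H) :
  (fun v : HH => (S v.1, T v.2) : HH) \in @bounded_op R HH.
Proof.
have [c c0 Sc] := bop_bounded S; have [d d0 Td] := bop_bounded T.
apply/bounded_opP; split.
  move=> a u v; exact: (congr2 (fun x y : H => (x, y) : HH)
    (bop_linear S a (u.1 : H) (v.1 : H)) (bop_linear T a (u.2 : H) (v.2 : H))).
exists (c + d) => [|v]; first exact: addr_ge0.
rewrite -(@ler_pXn2r _ 2)// ?nnegrE ?mulr_ge0 ?addr_ge0 ?rnorm_ge0//.
rewrite exprMn !rnorm_pair mulrDr /=.
have le2 (U : bop H) k (x : H) : 0 <= k -> k <= c + d -> rnorm (U x) <= k * rnorm x ->
    rnorm (U x) ^+ 2 <= (c + d) ^+ 2 * rnorm x ^+ 2.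
  move=> k0 kcd Ux; rewrite -exprMn ler_pXn2r ?nnegrE ?mulr_ge0 ?addr_ge0 ?rnorm_ge0//.
  by apply: (le_trans Ux); rewrite ler_wpM2r ?rnorm_ge0.
by rewrite lerD// ?(le2 S c)// ?(le2 T d)// ?lerDl ?lerDr.
Qed.

Definition pair_bop (S T : bop H) : bop HH := BOp (pair_bop_subproof S T).

Lemma pair_bopP a (S T S' T' : bop H) :
  pair_bop (a *: S + S') (a *: T + T') = a *: pair_bop S T + pair_bop S' T'.
Proof. exact: bop_ext. Qed.

Lemma pair_bop_comp (S T S' T' : bop H) :
  pair_bop (bop_comp S S') (bop_comp T T') = bop_comp (pair_bop S T) (pair_bop S' T').
Proof. exact: bop_ext. Qed.

Lemma pair_bop_adjoint (S T S' T' : bop H) : is_adjoint S S' -> is_adjoint T T' ->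
  is_adjoint (pair_bop S T) (pair_bop S' T').
Proof. by move=> SS' TT' u v; rewrite !hdot_pair /= SS' TT'. Qed.

Fact swap_subproof : (fun v : HH => (v.2, v.1) : HH) \in @bounded_op R HH.
Proof.
apply/bounded_opP; split=> //; exists 1 => // v.
by rewrite mul1r -(@ler_pXn2r _ 2)// ?nnegrE ?rnorm_ge0// !rnorm_pair /= addrC.
Qed.

Definition swap : bop HH := BOp swap_subproof.

Lemma swapK : bop_comp swap swap = bop_id.
Proof. by apply: bop_ext => -[]. Qed.

Lemma swap_symmetry : symmetry swap.
Proof.
have sa : is_adjoint swap swap by move=> u v; rewrite !hdot_pair /= addrC.
by split=> //; exists swap; split=> //; exact: swapK.
Qed.

Lemma swap_conj (S T : bop H) :
  bop_comp (bop_comp swap (pair_bop S T)) swap = pair_bop T S.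
Proof. exact: bop_ext. Qed.

End HilbertProduct.

(** * The doubled representation, its bounds and its closed range *)

Section KreinRepresentation.
Context {R : realType} (A : operatorStarAlgType R).
Local Notation C := R[i].
Local Notation X := (dual_rawHilbert (qsum_form (@index_form R A))).
Local Notation H := (rep_hilbert A).
Local Notation HH := (hilb (pair_rawHilbert X)).

Definition rho (a : A) : bop H := sval (cid (adjoint_exists (trep (dagger a)))).

Lemma rhoP a : is_adjoint (trep (dagger a)) (rho a).
Proof. by rewrite /rho; case: cid. Qed.

Lemma rho_dagger a : is_adjoint (trep a) (rho (dagger a)).
Proof. by have := rhoP (dagger a); rewrite daggerK. Qed.

Lemma is_adjointP (K : hilbertType R) (t : C) (S T S' T' : bop K) :
  is_adjoint S S' -> is_adjoint T T' -> is_adjoint (t^* *: S + T) (t *: S' + T').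
Proof.
move=> SS' TT' x y; rewrite -[(_ + T) x]/(t^* *: S x + T x) -[(_ + T') y]/(t *: S' y + T' y).
by rewrite linearDl /= linearDr /= linearZl_LR /= linearZr_LR /= SS' TT'.
Qed.

Lemma is_adjointM (K : hilbertType R) (S T S' T' : bop K) :
  is_adjoint S S' -> is_adjoint T T' -> is_adjoint (bop_comp S T) (bop_comp T' S').
Proof. by move=> SS' TT' x y; rewrite /= SS' TT'. Qed.

Lemma rho_linear t a b : rho (t *: a + b) = t *: rho a + rho b.
Proof.
apply: (is_adjoint_unique (rhoP _)); rewrite daggerD daggerZ trep_linear.
by apply: is_adjointP; exact: rhoP.
Qed.

Lemma rhoM a b : rho (oamul a b) = bop_comp (rho a) (rho b).
Proof.
apply: (is_adjoint_unique (rhoP _)); rewrite daggerM trepM.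
by apply: is_adjointM; exact: rhoP.
Qed.

Definition krein_rep (a : A) : bop HH := pair_bop (trep a) (rho a).

Fact krein_rep_linear : linear krein_rep.
Proof.
by move=> t a b; rewrite /krein_rep trep_linear rho_linear; exact: pair_bopP.
Qed.

HB.instance Definition _ := GRing.isLinear.Build C A (bop HH) _ krein_rep krein_rep_linear.

Lemma krein_repM a b : krein_rep (oamul a b) = bop_comp (krein_rep a) (krein_rep b).
Proof. by rewrite /krein_rep trepM rhoM; exact: pair_bop_comp. Qed.

(** The adjoint of [trep a] is [rho (dagger a)] and that of [rho a] is [trep (dagger a)]: taking
    adjoints replaces [a] by [dagger a] and exchanges the summands. *)
Lemma krein_rep_adjoint a : is_adjoint (krein_rep a)
  (bop_comp (bop_comp (swap X) (krein_rep (dagger a))) (swap X)).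
Proof.
rewrite /krein_rep swap_conj; apply: pair_bop_adjoint; first exact: rho_dagger.
by apply: adjoint_sym; exact: rhoP.
Qed.

Lemma trep_rnorm_contr (m : nat) (c : 'M[A]_m) (f : 'I_m -> H) : mnorm c <= 2^-1 ->
  \sum_i rnorm (\sum_j trep (c i j) (f j)) ^+ 2 <= \sum_j rnorm (f j) ^+ 2.
Proof.
move=> c1; have E (g : 'I_m -> H) : \sum_i rnorm (g i) ^+ 2 =
    \sum_i dual_form (qsum_form (@index_form R A)) (g i).
  by apply: eq_bigr => i _; exact: rep_hilbert_sqr.
rewrite !E; exact: trep_contr.
Qed.

(** The adjoint matrix consists of [trep] at the entrywise dagger of the transpose of [c], which has
    the norm of [c]: here the isometry of [dagger] on matrices enters. *)
Lemma rho_rnorm_contr (m : nat) (c : 'M[A]_m) (f : 'I_m -> H) : mnorm c <= 2^-1 ->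
  \sum_i rnorm (\sum_j rho (c i j) (f j)) ^+ 2 <= \sum_j rnorm (f j) ^+ 2.
Proof.
move=> c1; apply: (adjoint_mx_contr (fun i j => rhoP (c i j))) => y.
pose d : 'M[A]_m := \matrix_(i, j) dagger (c j i).
have d1 : mnorm d <= 2^-1 by rewrite mnorm_dagger.
apply: le_trans (trep_rnorm_contr y d1); rewrite le_eqVlt; apply/orP; left; apply/eqP.
by apply: eq_bigr => j _; congr (rnorm _ ^+ 2); apply: eq_bigr => i _; rewrite mxE.
Qed.

Lemma krein_rep_contr (m : nat) (c : 'M[A]_m) (v : 'I_m -> HH) : mnorm c <= 2^-1 ->
  \sum_i rnorm (\sum_j krein_rep (c i j) (v j)) ^+ 2 <= \sum_j rnorm (v j) ^+ 2.
Proof.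
move=> c1.
rewrite (eq_bigr (fun i => rnorm (\sum_j trep (c i j) (v j).1) ^+ 2 +
    rnorm (\sum_j rho (c i j) (v j).2) ^+ 2)); last first.
  by move=> i _; rewrite rnorm_pair sum_fst sum_snd.
rewrite [leRHS](eq_bigr (fun j => rnorm ((v j).1 : H) ^+ 2 + rnorm ((v j).2 : H) ^+ 2)); last first.
  by move=> j _; rewrite rnorm_pair.
rewrite !big_split; apply: lerD; first exact: trep_rnorm_contr.
exact: rho_rnorm_contr.
Qed.

(** x / r is a half-contraction. A positive majorant [r] stands in for 2 |x|, which may vanish. *)
Lemma krein_rep_bound (m : nat) (x : 'M[A]_m) (r : R) : 0 < r -> 2 * mnorm x <= r ->
  forall v : 'I_m -> HH, \sum_i rnorm (\sum_j map_mx krein_rep x i j (v j)) ^+ 2 <=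
    r ^+ 2 * \sum_j rnorm (v j) ^+ 2.
Proof.
move=> r0 xr v; pose c := map_mx ( *:%R (r^-1%:C%C : C)) x.
have c1 : mnorm c <= 2^-1.
  rewrite mnormZ rnorm_real ger0_norm; last by rewrite invr_ge0 ltW.
  by rewrite ler_pdivrMl//; lra.
have := krein_rep_contr v c1; rewrite -ler_pdivrMl ?exprn_gt0//.
apply: le_trans; rewrite mulr_sumr le_eqVlt; apply/orP; left; apply/eqP.
apply: eq_bigr => i _.
rewrite (_ : \sum_j krein_rep (c i j) (v j) = r^-1%:C%C *: \sum_j map_mx krein_rep x i j (v j)).
  by rewrite rnormZ exprMn rnorm_real real_normK ?num_real// exprVn.
by rewrite scaler_sumr; apply: eq_bigr => j _; rewrite !mxE linearZ.
Qed.

Lemma krein_rep_mnorm_le (m : nat) (x : 'M[A]_m) : mnorm (map_mx krein_rep x) <= 2 * mnorm x.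
Proof.
apply/ler_addgt0Pr => e e0.
have r0 : 0 < 2 * mnorm x + e by rewrite ltr_wpDl// mulr_ge0// mnorm_ge0.
apply: bop_mnorm_le; first exact: ltW.
by apply: krein_rep_bound => //; rewrite lerDl ltW.
Qed.

(** On the vectors [(f j, 0)] of the first summand, the estimates of [trep_lower] give S^2 <= M^2 S
    with |x|^2 <= S. *)
Lemma krein_rep_mnorm_ge (m : nat) (x : 'M[A]_m) : mnorm x <= mnorm (map_mx krein_rep x).
Proof.
have [f [xf fS]] := trep_lower x; set S := \sum_j _ in xf fS.
have S0 : 0 <= S by apply: le_trans xf; exact: sqr_ge0.
pose M := mnorm (map_mx krein_rep x).
have M0 : 0 <= M by exact: l2opnorm_ge0.
suff SM : S <= M ^+ 2.
  by rewrite -(@ler_pXn2r _ 2)// ?nnegrE ?mnorm_ge0//; exact: le_trans SM.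
have [->|Sn0] := eqVneq S 0; first exact: sqr_ge0.
have Sp : 0 < S by rewrite lt_def Sn0.
rewrite -(ler_pM2r Sp) -expr2; apply: (le_trans fS).
have r0 : 0 < 2 * mnorm x + 1 by rewrite ltr_wpDl// mulr_ge0// mnorm_ge0.
have xr : 2 * mnorm x <= 2 * mnorm x + 1 by rewrite lerDl.
pose v (j : 'I_m) : HH := (f j, 0).
have := bop_mnorm_ge (ltW r0) (krein_rep_bound r0 xr) v; rewrite -/M.
have -> : \sum_j rnorm (v j) ^+ 2 = S.
  by apply: eq_bigr => j _; rewrite rnorm_pair /= rnorm0 expr0n addr0 rep_hilbert_sqr.
apply: le_trans; apply: ler_sum => i _.
have -> : rnorm (\sum_j map_mx krein_rep x i j (v j)) ^+ 2 =
    rnorm (\sum_j trep (x i j) (f j)) ^+ 2 +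
    rnorm (\sum_j ((map_mx krein_rep x i j (v j)).2 : H)) ^+ 2.
  rewrite rnorm_pair sum_fst sum_snd; congr (rnorm _ ^+ 2 + _).
  by apply: eq_bigr => j _; rewrite mxE.
rewrite -[leLHS]rep_hilbert_sqr.
by rewrite lerDl sqr_ge0.
Qed.

Lemma rnorm_le_krein_rep a : rnorm a <= rnorm (krein_rep a).
Proof.
rewrite -mnorm_M1; apply: (le_trans (krein_rep_mnorm_ge _)).
apply: bop_mnorm_le; first exact: rnorm_ge0.
move=> v; rewrite !big_ord_recl !big_ord0 !addr0 !mxE -exprMn.
by rewrite ler_pXn2r ?nnegrE ?mulr_ge0 ?rnorm_ge0// bop_normP.
Qed.

Lemma krein_rep_rnorm_le a (r : R) : 0 < r -> 2 * rnorm a <= r -> rnorm (krein_rep a) <= r.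
Proof.
move=> r0 ar; apply: bop_norm_le; first exact: ltW.
have ar' : 2 * mnorm (const_mx a : 'M[A]_1) <= r by rewrite mnorm_M1.
move=> v; rewrite -(@ler_pXn2r _ 2)// ?nnegrE ?mulr_ge0 ?rnorm_ge0 ?(ltW r0)//.
have := krein_rep_bound r0 ar' (fun _ => v).
by rewrite !big_ord_recl !big_ord0 !addr0 !mxE exprMn.
Qed.

(** By the lower estimate, preimages of a convergent sequence are Cauchy in the complete space [A];
    by the upper one, the image of their limit is the given operator. *)
Lemma krein_rep_closed : closed (range krein_rep).
Proof.
move=> T Tcl.
have near (k : nat) : exists a, rnorm (T - krein_rep a) < k.+1%:R^-1.
  have k0 : 0 < (k.+1%:R^-1 : R)%:C%C by rewrite ltcR invr_gt0.
  have [_ [[a _ <-] aT]] := Tcl _ (nbhsx_ballx T _ k0).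
  by exists a; rewrite -ltcR rnormE; move: aT; rewrite -ball_normE.
have {near} [a aT] := choice near.
have inv_small (e : R) : 0 < e -> exists n0, forall n, (n0 <= n)%N -> n.+1%:R^-1 <= e.
  move=> e0; exists (Num.bound e^-1) => n n0n.
  rewrite -[e]invrK lef_pV2 ?posrE ?invr_gt0//; apply: ltW.
  apply: (lt_le_trans (archi_boundP _)); first by rewrite invr_ge0 ltW.
  by rewrite ler_nat (leq_trans n0n).
have aa m n : rnorm (a m - a n) < m.+1%:R^-1 + n.+1%:R^-1.
  apply: (le_lt_trans (rnorm_le_krein_rep _)); rewrite linearB /=.
  rewrite -(subrKA T) (le_lt_trans (rnormD _ _))// ltrD//.
  by rewrite -rnormN opprB.
have acvg : cvg (a @ \oo).
  apply/cauchy_cvgP/cauchy_exP => e e0.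
  have er : 0 < complex.Re e by move: e0; rewrite ltcE => /andP[].
  have eE : e = (complex.Re e)%:C%C by rewrite RRe_real// gtr0_real.
  have [n0 n0P] := inv_small _ (divr_gt0 er (ltr0Sn R 1)).
  exists (a n0); exists n0 => // n /= n0n; rewrite -ball_normE /=.
  rewrite eE -rnormE ltcR (lt_le_trans (aa _ _))//.
  by rewrite (splitr (complex.Re e)) lerD// n0P.
pose l := lim (a @ \oo); exists l => //.
apply/eqP; rewrite eq_sym -subr_eq0; apply/eqP/rnorm0_eq0/eqP; rewrite eq_le rnorm_ge0 andbT.
apply/ler_addgt0Pr => e' e'0; rewrite add0r.
(* One [e] for approximating [T], two for the image of [a n - l], since [krein_rep] at most doubles
   norms. *)
have [e e3 e0] : exists2 e : R, e + 2 * e = e' & 0 < e.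
  by exists (e' / 3); [field | rewrite divr_gt0].
have [n0 n0P] := inv_small e e0.
have eC : 0 < e%:C%C :> R[i] by rewrite ltcR.
have /cvgrPdist_lt /(_ _ eC) [n1 _ n1P] := acvg.
pose n := maxn n0 n1.
have ln : rnorm (l - a n) < e.
  by rewrite -ltcR rnormE; apply: n1P; rewrite /= leq_maxr.
have Tn : rnorm (T - krein_rep (a n)) <= e.
  by apply: le_trans (ltW (aT n)) _; apply: n0P; rewrite leq_maxl.
have an : rnorm (krein_rep (a n - l)) <= 2 * e.
  apply: krein_rep_rnorm_le; first by rewrite mulr_gt0.
  by rewrite ler_pM2l// -rnormN opprB ltW.
rewrite -(subrKA (krein_rep (a n))) (le_trans (rnormD _ _))//.
move: an; rewrite linearB /= => an.
by rewrite -e3; exact: (lerD Tn an).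
Qed.

End KreinRepresentation.

Theorem proposition1p1 (R : realType) (A : operatorStarAlgType R) :
  exists (H : hilbertType R) (B : set (bop H)) (u : bop H)
         (f : {linear A -> bop H}),
    [/\ closed_subalgebra B,
        symmetry u,
        cb_isomorphism_onto B f &
        forall a : A,
          is_adjoint (f a) (bop_comp (bop_comp u (f (dagger a))) u)].
Proof.
exists (hilb (pair_rawHilbert (dual_rawHilbert (qsum_form (@index_form R A))))).
exists (range (@krein_rep R A)), (swap _), (@krein_rep R A); split.
- split.
  + by exists 0 => //; exact: linear0.
  + by move=> t _ _ [a _ <-] [b _ <-]; exists (t *: a + b) => //; exact: linearP.
  + by move=> _ _ [a _ <-] [b _ <-]; exists (oamul a b) => //; exact: krein_repM.
  + exact: krein_rep_closed.
- exact: swap_symmetry.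
- split; first exact: krein_repM.
    by exists 2 => n x _; exact: krein_rep_mnorm_le.
  (* Off the range the value 0 is arbitrary. *)
  pose g (T : bop _) : A := if pselect (range (@krein_rep R A) T) is left h
    then sval (cid2 h) else 0.
  have fg T : range (@krein_rep R A) T -> krein_rep (g T) = T.
    by rewrite /g; case: pselect => // h _; case: cid2.
  have finj : injective (@krein_rep R A).
    move=> a b ab; apply/eqP; rewrite -subr_eq0; apply/eqP/rnorm0_eq0/eqP.
    rewrite eq_le rnorm_ge0 andbT; apply: le_trans (rnorm_le_krein_rep _) _.
    by rewrite linearB /= ab subrr rnorm0.
  exists g; split.
  + by move=> a; exists a.
  + by move=> a; apply: finj; rewrite fg//; exists a.
  + by move=> T; rewrite inE => /fg.
  (* The lower estimate makes the inverse completely contractive. *)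
  + exists 1 => n x xB; rewrite mul1r; apply: (le_trans (krein_rep_mnorm_ge _)).
    rewrite (_ : map_mx _ _ = x)//; apply/matrixP => i j; rewrite !mxE.
    exact: fg.
- exact: krein_rep_adjoint.
Qed.
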